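(* Let $\mathcal{D}\subseteq\mathbb{Z}_{\geq 0}$ have at least two elements, let $r=\min(\mathcal{D})$ and $p=\gcd\{d_1-d_2\mid d_1,d_2\in\mathcal{D}\}$. Let $m,n$ be integers tending to infinity such that $2m/n$ stays in a fixed compact interval of $]r,\max(\mathcal{D})[$ and $p$ divides $2m-rn$. Then \[ \sum_{G\in\operatorname{MG}^{(\mathcal{D})}_{n,m}}\kappa(G)=\frac{(2m)!}{2^m m!}\,\frac{p}{\sqrt{2\pi n\zeta\phi'(\zeta)}}\,\frac{\operatorname{Set}_{\mathcal{D}}(\zeta)^n}{\zeta^{2m}}\,(1+O(n^{-1})), \] where $\phi(x)=\frac{x\operatorname{Set}_{\mathcal{D}-1}(x)}{\operatorname{Set}_{\mathcal{D}}(x)}$ and $\zeta$ is the unique positive solution of $\phi(\zeta)=\frac{2m}{n}$.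
   Context: A multigraph $G$ on vertex set $\{1,\dots,n\}$ has a multiset $E(G)$ of edges, each an unordered pair $\{v,w\}$ of vertices with possibly $v=w$ (a loop). The degree of a vertex is its number of occurrences in $E(G)$ (a loop contributes $2$). $\operatorname{MG}^{(\mathcal{D})}_{n,m}$ is the set of multigraphs on $\{1,\dots,n\}$ with $m$ edges (with multiplicity) and all degrees in $\mathcal{D}$. An ordering of $G$ is a sequence $((v_1,w_1),\dots,(v_m,w_m))$ of ordered pairs with $\{\{v_i,w_i\}\}=E(G)$ as multisets; $\kappa(G)={\sf orderings}(G)/(2^m m!)$ where ${\sf orderings}(G)$ is the number of orderings. $\operatorname{Set}_{\mathcal{D}}(x)=\sum_{d\in\mathcal{D}}x^d/d!$ and $\mathcal{D}-i=\{d-i\mid d\in\mathcal{D}, d\geq i\}$; $\max(\mathcal{D})=+\infty$ if $\mathcal{D}$ is infinite. The $O(n^{-1})$ is uniform over $2m/n$ in the compact interval. *)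

(* Defs.v *)
From mathcomp Require Import all_boot all_order all_algebra.
From mathcomp Require Import all_classical all_reals all_analysis.

Set Implicit Arguments.
Unset Strict Implicit.
Unset Printing Implicit Defensive.

Import Order.TTheory GRing.Theory Num.Theory.
Import numFieldNormedType.Exports.

Local Open Scope classical_set_scope.
Local Open Scope ring_scope.

(* The unordered pair {v, w}; a loop is a singleton. *)
Definition edge (n : nat) := {e : {set 'I_n} | (0 < #|e| <= 2)%N}.

(* Multigraphs on n vertices with m edges: G e is the multiplicity of e in
   E(G). Bounding multiplicities by m loses nothing and gives a finite type. *)
Definition multigraph (n m : nat) :=
  {G : {ffun edge n -> 'I_m.+1} | (\sum_e (G e : nat) == m)%N}.

Definition mult (n m : nat) (G : multigraph n m) (e : edge n) : nat :=
  val G e.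

(* Occurrences of v in e: a loop at v counts twice. *)
Definition occ (n : nat) (v : 'I_n) (e : edge n) : nat :=
  if v \in val e then (if #|val e| == 1%N then 2 else 1)%N else 0%N.

Definition deg (n m : nat) (G : multigraph n m) (v : 'I_n) : nat :=
  (\sum_e mult G e * occ v e)%N.

Definition degrees_in (D : set nat) (n m : nat) (G : multigraph n m) : bool :=
  [forall v : 'I_n, deg G v \in D].

Definition is_ordering (n m : nat) (G : multigraph n m)
    (s : m.-tuple ('I_n * 'I_n)) : bool :=
  [forall e : edge n,
     count (fun vw : 'I_n * 'I_n => [set vw.1; vw.2]%SET == val e) s
       == mult G e].

Definition orderings (n m : nat) (G : multigraph n m) : nat :=
  #|[pred s : m.-tuple ('I_n * 'I_n) | is_ordering G s]|.

Definition kappa (R : realType) (n m : nat) (G : multigraph n m) : R :=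
  (orderings G)%:R / (2 ^ m * m`!)%:R.

(* Set_D(x), the sum of x^d / d! over d in D. *)
Definition SetD (R : realType) (D : set nat) (x : R) : R :=
  limn (pseries (fun d => (d \in D)%:R / d`!%:R) x).

Definition shiftD (D : set nat) (i : nat) : set nat :=
  [set (d - i)%N | d in [set d | D d /\ (i <= d)%N]].

Definition phi (R : realType) (D : set nat) (x : R) : R :=
  x * SetD (shiftD D 1) x / SetD D x.

Definition is_min (D : set nat) (r : nat) : Prop :=
  D r /\ forall d, D d -> (r <= d)%N.

(* max(D) for nonempty D, equal to +oo when D is infinite. *)
Definition maxD (R : realType) (D : set nat) : \bar R :=
  ereal_sup [set d%:R%:E | d in D].

Definition divides_differences (D : set nat) (k : nat) : Prop :=
  forall d1 d2, D d1 -> D d2 -> (k%:Z %| d1%:Z - d2%:Z)%Z.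

Definition is_gcd_differences (D : set nat) (p : nat) : Prop :=
  divides_differences D p /\
  forall k, divides_differences D k -> (k %| p)%N.

Definition main_term (R : realType) (D : set nat) (p n m : nat) (zeta : R) : R :=
  (2 * m)`!%:R / (2 ^ m * m`!)%:R
  * (p%:R / Num.sqrt (2 * pi * n%:R * zeta * derive1 (@phi R D) zeta))
  * (SetD D zeta ^+ n / zeta ^+ (2 * m)).

(* Main.v *)
(** An ordering of a multigraph with all degrees in D is a word of length 2m
    over the vertices whose letter counts lie in D, so the sum of the [kappa G]
    is (2m)!/(2^m m!) times the coefficient of x^(2m) in Set_D(x)^n.

    Give d the probability [d in D] zeta^d / (d! Set_D(zeta)): this law has mean
    phi(zeta) = 2m/n and variance zeta phi'(zeta), and the coefficient becomes
    the probability that n independent copies have sum 2m, a Fourier integral of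
    the n-th power of the characteristic function z of the centered law.
    Periodicity reduces the integral to [-pi/p, pi/p], where
    |z(t)|^2 <= 1 - c t^2 because p is the gcd of the differences of elements
    of D. With w(t) = exp(- zeta phi'(zeta) t^2 / 2), the expansion
    z^n = w^n + n w^(n-1) (z - w) + O(n^2 exp(- c n t^2 / 2) |z - w|^2)
    gives a relative error O(1/n), because Re(z - w) = O(t^4) and
    Im z = O(t^3). All constants are uniform for zeta in a compact interval. *)

Require Import Defs.
From mathcomp Require Import all_boot all_order all_algebra.
From mathcomp Require Import all_classical all_reals all_analysis.
From mathcomp Require Import measurable_realfun complex ring lra zify.

Set Implicit Arguments.
Unset Strict Implicit.
Unset Printing Implicit Defensive.

Import Order.TTheory GRing.Theory Num.Theory.
Import numFieldNormedType.Exports.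
Import ComplexField.Normc.

Local Open Scope classical_set_scope.
Local Open Scope ring_scope.

(** * Counting orderings *)

Lemma deriv_prod (A : comNzRingType) (I : eqType) (r : seq I)
    (F : I -> {poly A}) : uniq r ->
  (\prod_(i <- r) F i)^`() =
  \sum_(j <- r) \prod_(i <- r) (F i)^`(j == i).
Proof.
elim: r => [|j r IHr] /=; first by rewrite !big_nil derivC.
case/andP=> jr ur; rewrite !big_cons derivM IHr // eqxx derivn1.
congr (_ * _ + _).
  apply: eq_big_seq => i ir.
  by rewrite eq_sym (negbTE (memPn jr i ir)).
rewrite mulr_sumr; apply: eq_big_seq => i ir.
by rewrite big_cons (negbTE (memPn jr i ir)).
Qed.

Lemma sum_cons_tuple (A : nmodType) (T : finType) (m : nat)
    (F : m.+1.-tuple T -> A) :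
  \sum_s F s = \sum_x \sum_(s : m.-tuple T) F (cons_tuple x s).
Proof.
rewrite pair_big (reindex (fun p : T * m.-tuple T => cons_tuple p.1 p.2)) //=.
exists (fun s => (thead s, behead_tuple s)) => [[x s] _|s _] /=.
  by congr (_, _); apply/val_inj.
by apply/val_inj; rewrite /= [in RHS](tuple_eta s).
Qed.

Definition occurrences (T : eqType) (s : seq (T * T)) (v : T) : nat :=
  (\sum_(x <- s) ((x.1 == v) + (x.2 == v)))%N.

Lemma occurrences_le (T : eqType) (s : seq (T * T)) (v : T) :
  (occurrences s v <= 2 * size s)%N.
Proof.
rewrite -sum1_size big_distrr; apply: leq_sum => x _ /=.
exact: (leq_add (leq_b1 _) (leq_b1 _)).
Qed.

Lemma derivn_prod_pairs (A : comNzRingType) (T : finType) (F : T -> {poly A})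
    (m : nat) :
  (\prod_v F v)^`(2 * m) =
  \sum_(s : m.-tuple (T * T)) \prod_v (F v)^`(occurrences s v).
Proof.
elim: m F => [|m IHm] F.
  rewrite (big_pred1 [tuple]) => [|s]; last by rewrite (tuple0 s) /= eqxx.
  by rewrite derivn0; apply: eq_bigr => v _; rewrite /occurrences big_nil.
rewrite sum_cons_tuple mulnS add2n !derivSn deriv_prod ?index_enum_uniq //.
rewrite linear_sum /=.
under [in LHS]eq_bigr do rewrite deriv_prod ?index_enum_uniq //.
rewrite pair_big linear_sum; apply: eq_bigr => -[u w] _ /=.
rewrite IHm; apply: eq_bigr => s _; apply: eq_bigr => v _.
by rewrite /occurrences big_cons /derivn -!iterD addnC addnAC addnA.
Qed.

Lemma card_pair_edge (n : nat) (x : 'I_n * 'I_n) :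
  (0 < #|[set x.1; x.2]%SET| <= 2)%N.
Proof. by rewrite cards2; case: eqP. Qed.

Definition pair_edge n (x : 'I_n * 'I_n) : edge n :=
  exist (fun e : {set 'I_n} => (0 < #|e| <= 2)%N) _ (card_pair_edge x).

Lemma occ_pair_edge n (v : 'I_n) (x : 'I_n * 'I_n) :
  occ v (pair_edge x) = ((x.1 == v) + (x.2 == v))%N.
Proof.
rewrite /occ /= !inE cards2 !(eq_sym v).
case: (eqVneq x.1 x.2) => [->|ne] /=; first by case: eqP.
case: eqVneq => [e|_] /=; last by case: eqP.
by rewrite -e eq_sym (negbTE ne).
Qed.

Definition edge_count n (s : seq ('I_n * 'I_n)) (e : edge n) : nat :=
  count (fun x => pair_edge x == e) s.

Lemma sum_edge_count n (s : seq ('I_n * 'I_n)) (g : edge n -> nat) :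
  (\sum_e edge_count s e * g e = \sum_(x <- s) g (pair_edge x))%N.
Proof.
elim: s => [|x s IHs]; first by rewrite big_nil big1.
rewrite big_cons -IHs (bigD1 (pair_edge x)) //=.
rewrite [in RHS](bigD1 (pair_edge x)) //=.
rewrite eqxx mulnDl mul1n addnA; congr (_ + _)%N.
by apply: eq_bigr => e; rewrite eq_sym => /negbTE ->.
Qed.

Lemma edge_count_lt n m (s : m.-tuple ('I_n * 'I_n)) (e : edge n) :
  (edge_count s e < m.+1)%N.
Proof. by rewrite ltnS -[X in (_ <= X)%N](size_tuple s) count_size. Qed.

Lemma sum_edge_count_tuple n m (s : m.-tuple ('I_n * 'I_n)) :
  (\sum_e ([ffun e => inord (edge_count s e) : 'I_m.+1] e : nat) == m)%N.
Proof.
apply/eqP; rewrite -[RHS](size_tuple s) -sum1_size.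
rewrite -(sum_edge_count s (fun=> 1%N)).
by apply: eq_bigr => e _; rewrite muln1 ffunE inordK ?edge_count_lt.
Qed.

Definition tuple_multigraph n m (s : m.-tuple ('I_n * 'I_n)) : multigraph n m :=
  exist (fun G : {ffun edge n -> 'I_m.+1} => (\sum_e (G e : nat) == m)%N) _
    (sum_edge_count_tuple s).

Lemma mult_tuple_multigraph n m (s : m.-tuple ('I_n * 'I_n)) (e : edge n) :
  mult (tuple_multigraph s) e = edge_count s e.
Proof. by rewrite /mult /= ffunE inordK ?edge_count_lt. Qed.

Lemma deg_tuple_multigraph n m (s : m.-tuple ('I_n * 'I_n)) (v : 'I_n) :
  deg (tuple_multigraph s) v = occurrences s v.
Proof.
rewrite /deg; under eq_bigr do rewrite mult_tuple_multigraph.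
rewrite sum_edge_count; apply: eq_bigr => x _; exact: occ_pair_edge.
Qed.

Lemma is_orderingE n m (G : multigraph n m) (s : m.-tuple ('I_n * 'I_n)) :
  is_ordering G s = (G == tuple_multigraph s).
Proof.
apply/forallP/eqP => [Gs|-> e]; last by rewrite mult_tuple_multigraph.
apply/val_inj/ffunP => e; apply/val_inj.
by rewrite -[RHS]/(mult _ e) mult_tuple_multigraph; exact/esym/eqP/(Gs e).
Qed.

Lemma sum_orderings (D : set nat) n m :
  (\sum_(G : multigraph n m | degrees_in D G) orderings G
   = \sum_(s : m.-tuple ('I_n * 'I_n)) [forall v, occurrences s v \in D])%N.
Proof.
rewrite /orderings; under eq_bigr do rewrite -sum1_card.
rewrite (exchange_big_dep xpredT) //=; apply: eq_bigr => s _.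
under eq_bigl do rewrite inE is_orderingE andbC.
rewrite big_mkcondr big_pred1_eq /degrees_in.
under eq_forallb do rewrite deg_tuple_multigraph.
by case: [forall _, _].
Qed.

Section convpow.
Context {A : comNzRingType}.
Implicit Types (P Q : {poly A}) (a : nat -> A).

(* The coefficient of x^k in the n-th power of the series of the a_d x^d, which
   only depends on the first k + 1 terms. *)
Definition convpow a n k : A := ((\poly_(d < k.+1) a d) ^+ n)`_k.

Lemma eq_coef_exprn P Q n k : (forall d, (d <= k)%N -> P`_d = Q`_d) ->
  (P ^+ n)`_k = (Q ^+ n)`_k.
Proof.
elim: n k => [|n IHn] k PQ; first by rewrite !expr0.
rewrite !exprS !coefM; apply: eq_bigr => i _; have ik := ltn_ord i.
rewrite PQ // (IHn (k - i)%N) // => d /leq_trans dk; apply: PQ.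
exact/dk/leq_subr.
Qed.

Lemma coef_poly_exprn a n k B : (k < B)%N ->
  ((\poly_(d < B) a d) ^+ n)`_k = convpow a n k.
Proof.
move=> kB; apply: eq_coef_exprn => d dk.
by rewrite !coef_poly ltnS dk (leq_ltn_trans dk kB).
Qed.

Lemma convpowS a n k :
  convpow a n.+1 k = \sum_(i < k.+1) a i * convpow a n (k - i).
Proof.
rewrite [LHS]/convpow exprS coefM; apply: eq_bigr => i _.
by rewrite coef_poly ltn_ord coef_poly_exprn // ltnS leq_subr.
Qed.

Lemma convpow_scale a z c n k :
  convpow (fun d => a d * z ^+ d * c) n k = convpow a n k * z ^+ k * c ^+ n.
Proof.
elim: n k => [|n IHn] k.
  rewrite /convpow !expr0 coef1 mulr1.
  by case: k => [|k]; rewrite ?mulr1 ?mul0r.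
rewrite !convpowS !mulr_suml; apply: eq_bigr => i _; rewrite IHn.
have -> : z ^+ k = z ^+ i * z ^+ (k - i) by rewrite -exprD subnKC // -ltnS.
by rewrite exprS; ring.
Qed.

Lemma coef_exprn_support P (r p : nat) :
  (forall k, P`_k != 0 -> (p%:Z %| k%:Z - r%:Z)%Z) ->
  forall n k, (P ^+ n)`_k != 0 -> (p%:Z %| k%:Z - (r * n)%:Z)%Z.
Proof.
move=> supp; elim=> [|n IHn] k.
  rewrite expr0 coef1; case: k => [|k] /=; last by rewrite eqxx.
  by rewrite muln0 subrr dvdz0.
rewrite exprS coefM; apply: contraR => ndvd; apply/eqP/big1 => i _.
have [->|Pi] := eqVneq P`_i 0; first by rewrite mul0r.
have [->|Pk] := eqVneq (P ^+ n)`_(k - i) 0; first by rewrite mulr0.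
have ik : (i <= k)%N by rewrite -ltnS.
case/negP: ndvd.
have -> : k%:Z - (r * n.+1)%:Z = (i%:Z - r%:Z) + ((k - i)%N%:Z - (r * n)%:Z).
  by rewrite -subzn // mulnS PoszD; ring.
by rewrite rpredD ?supp ?IHn.
Qed.

End convpow.

Definition weight (R : realType) (D : set nat) (d : nat) : R :=
  (d \in D)%:R / d`!%:R.

Lemma sum_kappa (R : realType) (D : set nat) (n m : nat) :
  \sum_(G : multigraph n m | degrees_in D G) kappa R G =
  (2 * m)`!%:R / (2 ^ m * m`!)%:R * convpow (weight R D) n (2 * m).
Proof.
rewrite /kappa -mulr_suml -natr_sum sum_orderings mulrAC; congr (_ / _).
rewrite /convpow; set F := \poly_(d < _) _.
have derivF k : (k <= 2 * m)%N -> (F^`(k)).[0] = (k \in D)%:R.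
  move=> km; rewrite horner_coef0 coef_derivn addn0 coef_poly ltnS km ffactnn.
  by rewrite /weight -[LHS]mulr_natr divfK // pnatr_eq0 -lt0n fact_gt0.
have <- : (\prod_(v < n) F)^`(2 * m).[0] = (2 * m)`!%:R * (F ^+ n)`_(2 * m).
  rewrite prodr_const card_ord horner_coef0 coef_derivn addn0 ffactnn.
  by rewrite -[LHS]mulr_natr mulrC.
rewrite derivn_prod_pairs horner_sum natr_sum; apply: eq_bigr => s _.
have occ_le v : (occurrences s v <= 2 * m)%N.
  by rewrite -[m in (_ <= 2 * m)%N](size_tuple s) occurrences_le.
rewrite horner_prod; under [RHS]eq_bigr do rewrite derivF //.
have [sD|] := boolP [forall v, occurrences s v \in D].
  by rewrite big1 // => v _; rewrite (forallP sD).
rewrite negb_forall => /existsP[v /negbTE vD].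
by rewrite (bigD1 v) //= vD mul0r.
Qed.

(** * Elementary inequalities *)

Section elementary_inequalities.
Context {R : realType}.
Implicit Types x y t : R.

Lemma le_of_derive (f g df dg : R -> R) :
  (forall x, is_derive x 1 f (df x)) -> (forall x, is_derive x 1 g (dg x)) ->
  (forall x, 0 <= x -> df x <= dg x) -> f 0 <= g 0 ->
  forall x, 0 <= x -> f x <= g x.
Proof.
move=> fdf gdg dfg fg0 x x0.
have dgf y : is_derive y 1 (g - f) (dg y - df y) by exact: is_deriveB.
have cgf : {within `[0, x], continuous (g - f)}.
  apply: continuous_subspaceT => y; apply: differentiable_continuous.
  by apply/derivable1_diffP; have [] := dgf y.
have [y] := MVT_segment x0 (fun y _ => dgf y) cgf.
rewrite in_itv /= => /andP[y0 _] E.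
have : 0 <= (g - f) x - (g - f) 0.
  by rewrite E subr0 mulr_ge0 // subr_ge0 dfg.
by rewrite !fctE; lra.
Qed.

Lemma sin_le_id x : 0 <= x -> sin x <= x.
Proof.
apply: (le_of_derive (g := id)) => [y _|]; last by rewrite sin0.
exact: cos_le1.
Qed.

Let horner_polyE := (hornerD, hornerN, hornerZ, hornerC, hornerXn, hornerMn,
  hornerX).

Lemma cos_ge_taylor2 x : 1 - x ^+ 2 / 2 <= cos x.
Proof.
wlog x0 : x / 0 <= x => [nonneg|].
  have [/nonneg//|/ltW x0] := leP 0 x.
  by rewrite -sqrrN -cosN; apply: nonneg; lra.
pose p : {poly R} := 1 - 2^-1 *: 'X^2.
have -> : 1 - x ^+ 2 / 2 = p.[x] by rewrite !horner_polyE; field.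
apply: (le_of_derive (is_derive_poly p) (@is_derive_cos R)) x0 => [y y0|].
  rewrite derivB derivZ derivXn derivC !horner_polyE.
  by have := sin_le_id y0; lra.
by rewrite cos0 !horner_polyE; lra.
Qed.

Lemma sin_ge_taylor3 x : 0 <= x -> x - x ^+ 3 / 6 <= sin x.
Proof.
pose p : {poly R} := 'X - 6^-1 *: 'X^3.
have -> : x - x ^+ 3 / 6 = p.[x] by rewrite !horner_polyE; field.
apply: (le_of_derive (is_derive_poly p) (@is_derive_sin R)) => [y y0|].
  rewrite derivB derivZ derivXn derivX !horner_polyE.
  by have := cos_ge_taylor2 y; lra.
by rewrite sin0 !horner_polyE; lra.
Qed.

Lemma cos_le_taylor4 x : cos x <= 1 - x ^+ 2 / 2 + x ^+ 4 / 24.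
Proof.
wlog x0 : x / 0 <= x => [nonneg|].
  have [/nonneg//|/ltW x0] := leP 0 x; rewrite -cosN -(sqrrN x).
  by rewrite (_ : x ^+ 4 = (- x) ^+ 4); [apply: nonneg; lra|ring].
pose p : {poly R} := 1 - 2^-1 *: 'X^2 + 24^-1 *: 'X^4.
have -> : 1 - x ^+ 2 / 2 + x ^+ 4 / 24 = p.[x] by rewrite !horner_polyE; field.
apply: (le_of_derive (@is_derive_cos R) (is_derive_poly p)) x0 => [y y0|].
  rewrite derivD derivB !derivZ !derivXn derivC !horner_polyE.
  by have := sin_ge_taylor3 y0; lra.
by rewrite cos0 !horner_polyE; lra.
Qed.

Lemma cos_taylor4 x : `|cos x - (1 - x ^+ 2 / 2)| <= x ^+ 4 / 24.
Proof.
have := cos_le_taylor4 x; have := cos_ge_taylor2 x.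
by have := exprn_even_ge0 x (isT : ~~ odd 4); rewrite ler_norml; lra.
Qed.

Lemma sin_taylor3 x : `|sin x - x| <= `|x| ^+ 3 / 6.
Proof.
wlog x0 : x / 0 <= x => [nonneg|].
  have [/nonneg//|/ltW x0] := leP 0 x.
  have -> : sin x - x = - (sin (- x) - - x) by rewrite sinN; ring.
  by rewrite normrN -(normrN x); apply: nonneg; lra.
have := sin_le_id x0; have := sin_ge_taylor3 x0; have := exprn_ge0 3 x0.
by rewrite (ger0_norm x0) ler_norml; lra.
Qed.

Lemma expRN_taylor2 x : 0 <= x -> `|expR (- x) - (1 - x)| <= x ^+ 2 / 2.
Proof.
pose p : {poly R} := 1 - 'X + 2^-1 *: 'X^2.
have pE y : p.[y] = 1 - y + y ^+ 2 / 2 by rewrite !horner_polyE; field.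
have dexp (y : R) : is_derive y 1 (@expR R \o -%R) (- expR (- y)).
  by apply: is_derive_eq; rewrite mulrN1.
move=> x0; have lower := expR_ge1Dx (- x).
have : expR (- x) <= p.[x].
  apply: (le_of_derive dexp (is_derive_poly p)) x0 => [y y0|].
    rewrite derivD derivB derivZ derivXn derivX derivC !horner_polyE.
    by have := expR_ge1Dx (- y); lra.
  by rewrite pE /= oppr0 expR0; lra.
by rewrite pE; have := sqr_ge0 x; rewrite ler_norml; lra.
Qed.

Lemma exprn_expRN_le k x : 0 <= x -> x ^+ k * expR (- x) <= k%:R ^+ k.
Proof.
move=> x0; rewrite expRN ler_pdivrMr ?expR_gt0 //.
case: k => [|k]; first by rewrite !expr0 mul1r -expR0 ler_expR.
have k0 : 0 < k.+1%:R :> R by [].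
have -> : x = k.+1%:R * (x / k.+1%:R) by rewrite mulrC divfK ?gt_eqF.
rewrite exprMn expRM_natl ler_pM2l ?exprn_gt0 //.
apply: lerXn2r; rewrite ?nnegrE ?expR_ge0 ?divr_ge0 //.
by apply: le_trans (expR_ge1Dx _); rewrite lerDr.
Qed.

Lemma sqr_le_sin_sqr x : `|x| <= 2 -> (x / 3) ^+ 2 <= sin x ^+ 2.
Proof.
wlog x0 : x / 0 <= x => [nonneg|].
  have [/nonneg//|/ltW x0 x2] := leP 0 x.
  rewrite -[sin x]opprK -sinN sqrrN -[x / 3]opprK sqrrN -mulNr.
  by apply: nonneg; rewrite ?normrN //; lra.
rewrite (ger0_norm x0) => x2; rewrite lerXn2r ?nnegrE ?divr_ge0 //.
  by apply: sin_ge0_pi; rewrite x0 (le_trans x2) ?pi_ge2.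
by apply: le_trans (sin_ge_taylor3 x0); rewrite exprSr; nra.
Qed.

Lemma sqrtr_div_mul x y : 0 <= x -> 0 < y ->
  Num.sqrt (x / y) * Num.sqrt (x * y) = x.
Proof.
move=> x0 y0; rewrite -sqrtrM ?divr_ge0 ?(ltW y0) //.
have -> : x / y * (x * y) = x ^+ 2 by field; rewrite gt_eqF.
by rewrite sqrtr_sqr ger0_norm.
Qed.

Lemma pi_le4 : pi <= 4 :> R.
Proof. by have := @pihalf_lt2 R; lra. Qed.

Lemma ler_sqr_norm x y : `|x| <= y -> x ^+ 2 <= y ^+ 2.
Proof.
move=> xy; rewrite -(real_normK (num_real x)).
by rewrite lerXn2r ?nnegrE // (le_trans _ xy).
Qed.

End elementary_inequalities.

(** * Complex numbers *)

Section complex_numbers.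
Context {R : realType}.
Implicit Types (z w : R[i]) (t : R).

Lemma normc_ge0 z : 0 <= normc z.
Proof. by case: z => x y; exact: sqrtr_ge0. Qed.

Lemma sqr_normc z : normc z ^+ 2 = complex.Re z ^+ 2 + complex.Im z ^+ 2.
Proof. by case: z => x y; rewrite sqr_sqrtr // addr_ge0 // sqr_ge0. Qed.

Lemma normcX z n : normc (z ^+ n) = normc z ^+ n.
Proof. by elim: n => [|n IHn]; rewrite ?normc1 // !exprS normcM IHn. Qed.

Lemma normc_real (x : R) : normc x%:C%C = `|x|.
Proof. by rewrite /= expr0n addr0 sqrtr_sqr. Qed.

Lemma normc_nat n : normc (n%:R : R[i]) = n%:R.
Proof. by rewrite -[n%:R]/(1 *+ n) normcMn normc1. Qed.

Lemma norm_Re_le z : `|complex.Re z| <= normc z.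
Proof.
rewrite -ler_sqr ?nnegrE ?normc_ge0 // real_normK ?num_real //.
by rewrite sqr_normc lerDl sqr_ge0.
Qed.

Lemma ReD z w : complex.Re (z + w) = complex.Re z + complex.Re w.
Proof. exact: (raddfD (@complex.Re R : Rcomplex R -> R)). Qed.

Lemma ImD z w : complex.Im (z + w) = complex.Im z + complex.Im w.
Proof. exact: (raddfD (@complex.Im R : Rcomplex R -> R)). Qed.

Lemma Re_sum (I : Type) (r : seq I) (F : I -> R[i]) :
  complex.Re (\sum_(i <- r) F i) = \sum_(i <- r) complex.Re (F i).
Proof. exact: (raddf_sum (@complex.Re R : Rcomplex R -> R)). Qed.

Lemma Im_sum (I : Type) (r : seq I) (F : I -> R[i]) :
  complex.Im (\sum_(i <- r) F i) = \sum_(i <- r) complex.Im (F i).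
Proof. exact: (raddf_sum (@complex.Im R : Rcomplex R -> R)). Qed.

Lemma ReZ (x : R) z : complex.Re (x%:C%C * z) = x * complex.Re z.
Proof. by case: z => ? ?; simpc. Qed.

Lemma ImZ (x : R) z : complex.Im (x%:C%C * z) = x * complex.Im z.
Proof. by case: z => ? ?; simpc. Qed.

Lemma normc_sum (I : Type) (r : seq I) (F : I -> R[i]) :
  normc (\sum_(i <- r) F i) <= \sum_(i <- r) normc (F i).
Proof.
elim/big_rec2: _ => [|i x z _ zx]; first by rewrite normc0.
by rewrite (le_trans (le_normcD _ _)) // lerD2l.
Qed.

Definition cis t : R[i] := Complex (cos t) (sin t).

Lemma normc_cis t : normc (cis t) = 1.
Proof. by rewrite /= cos2Dsin2 sqrtr1. Qed.

Lemma cisD s t : cis (s + t) = cis s * cis t.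
Proof. by rewrite /cis cosD sinD; simpc; congr (Complex _ _); ring. Qed.

Lemma cisMn n t : cis (n%:R * t) = cis t ^+ n.
Proof.
elim: n => [|n IHn]; first by rewrite mul0r /cis cos0 sin0.
by rewrite -natr1 mulrDl mul1r cisD IHn exprSr.
Qed.

(* The remainders T_n on the left-hand side satisfy
   T_(n+1) = z T_n + n w^(n-1) (z - w)^2. *)
Lemma normc_expr_taylor z w (rho : R) n :
  normc z <= rho -> normc w <= rho ->
  normc (z ^+ n.+2 - w ^+ n.+2 - n.+2%:R * w ^+ n.+1 * (z - w))
  <= n.+2%:R ^+ 2 * rho ^+ n * normc (z - w) ^+ 2.
Proof.
move=> zr wr; have rho0 := le_trans (normc_ge0 z) zr.
set d := z - w; elim: n => [|n IHn].
  have -> : z ^+ 2 - w ^+ 2 - 2%:R * w ^+ 1 * d = d ^+ 2 by rewrite /d; ring.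
  by rewrite normcX mulr1 ler_peMl ?sqr_ge0 // expr_ge1 ?ler1n.
have -> : z ^+ n.+3 - w ^+ n.+3 - n.+3%:R * w ^+ n.+2 * d =
    z * (z ^+ n.+2 - w ^+ n.+2 - n.+2%:R * w ^+ n.+1 * d)
    + n.+2%:R * w ^+ n.+1 * d ^+ 2.
  by rewrite /d -!natr1 !exprS; ring.
set T := z ^+ n.+2 - _ - _ in IHn *.
have leading_le : normc (z * T) <= n.+2%:R ^+ 2 * rho ^+ n.+1 * normc d ^+ 2.
  have -> : n.+2%:R ^+ 2 * rho ^+ n.+1 * normc d ^+ 2 =
      rho * (n.+2%:R ^+ 2 * rho ^+ n * normc d ^+ 2).
    by rewrite (exprS rho); ring.
  by rewrite normcM ler_pM ?normc_ge0.
have correction_le : normc (n.+2%:R * w ^+ n.+1 * d ^+ 2) <=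
    n.+2%:R * rho ^+ n.+1 * normc d ^+ 2.
  rewrite !normcM normc_nat !normcX ler_wpM2r ?sqr_ge0 // ler_wpM2l //.
  by rewrite lerXn2r ?nnegrE ?normc_ge0.
apply: le_trans (le_normcD _ _) _.
apply: le_trans (lerD leading_le correction_le) _.
rewrite -!mulrDl !ler_wpM2r ?sqr_ge0 ?exprn_ge0 //.
by rewrite -(natr1 n.+2); have := ler0n R n.+2; nra.
Qed.

Lemma norm_Re_expr_sub z (w rho : R) n : 0 <= w -> w <= rho -> normc z <= rho ->
  `|complex.Re (z ^+ n.+2) - w ^+ n.+2|
  <= n.+2%:R ^+ 2 * rho ^+ n * normc (z - w%:C%C) ^+ 2
     + n.+2%:R * rho ^+ n.+1 * `|complex.Re z - w|.
Proof.
move=> w0 wr zr.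
have nw : normc w%:C%C <= rho by rewrite normc_real ger0_norm.
have := normc_expr_taylor n zr nw; set T := z ^+ n.+2 - _ - _ => T_le.
have -> : complex.Re (z ^+ n.+2) - w ^+ n.+2 =
    complex.Re T + n.+2%:R * w ^+ n.+1 * (complex.Re z - w).
  have -> : z ^+ n.+2 =
      T + ((w ^+ n.+2)%:C%C + (n.+2%:R * w ^+ n.+1)%:C%C * (z - w%:C%C)).
    by rewrite [(n.+2%:R * _)%:C%C]rmorphM rmorph_nat !rmorphXn /T; ring.
  by rewrite !ReD ReZ -[- _%:C%C]rmorphN ReD /=; ring.
apply: le_trans (ler_normD _ _) _; apply: lerD.
  exact: le_trans (norm_Re_le T) T_le.
rewrite normrM ler_wpM2r // ger0_norm ?mulr_ge0 ?exprn_ge0 // ler_wpM2l //.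
by rewrite lerXn2r ?nnegrE // (le_trans w0).
Qed.

Lemma cvg_Re_Im_exprn (u : nat -> R[i]) z n :
  (fun k => complex.Re (u k)) @ \oo --> complex.Re z ->
  (fun k => complex.Im (u k)) @ \oo --> complex.Im z ->
  (fun k => complex.Re (u k ^+ n)) @ \oo --> complex.Re (z ^+ n) /\
  (fun k => complex.Im (u k ^+ n)) @ \oo --> complex.Im (z ^+ n).
Proof.
move=> cRe cIm; have ReM (x y : R[i]) : complex.Re (x * y) =
  complex.Re x * complex.Re y - complex.Im x * complex.Im y by case: x; case: y.
have ImM (x y : R[i]) : complex.Im (x * y) =
  complex.Re x * complex.Im y + complex.Im x * complex.Re y by case: x; case: y.
elim: n => [|n [IHRe IHIm]]; first by split; exact: cvg_cst.
split.
  rewrite exprS ReM; under eq_fun do rewrite exprS ReM.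
  by apply: cvgB; apply: cvgM.
rewrite exprS ImM; under eq_fun do rewrite exprS ImM.
by apply: cvgD; apply: cvgM.
Qed.

End complex_numbers.

(** * Characteristic functions *)

Section expectation.
Context {R : realType}.
Implicit Types (q F G : nat -> R) (l : R).

Definition has_expectation q F l :=
  series (fun d => q d * F d) @ \oo --> l.

Lemma eq_has_expectation q F G l : F =1 G ->
  has_expectation q F l -> has_expectation q G l.
Proof. by move/funext ->. Qed.

Lemma has_expectationD q F G l l' : has_expectation q F l ->
  has_expectation q G l' -> has_expectation q (fun d => F d + G d) (l + l').
Proof.
move=> EF EG; rewrite /has_expectation.
have -> : (fun d => q d * (F d + G d)) =
    (fun d => q d * F d) + (fun d => q d * G d).
  by apply/funext => d; rewrite mulrDr.
by rewrite seriesD; exact: cvgD.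
Qed.

Lemma has_expectationZ q F l a : has_expectation q F l ->
  has_expectation q (fun d => a * F d) (a * l).
Proof.
move=> EF; rewrite /has_expectation.
have -> : (fun d => q d * (a * F d)) = a *: (fun d => q d * F d).
  by apply/funext => d; rewrite mulrCA.
by rewrite seriesZ; exact: cvgZr.
Qed.

Lemma has_expectationB q F G l l' : has_expectation q F l ->
  has_expectation q G l' -> has_expectation q (fun d => F d - G d) (l - l').
Proof.
move=> EF /(has_expectationZ (a := -1)) /(has_expectationD EF); rewrite mulN1r.
by apply: eq_has_expectation => d; rewrite mulN1r.
Qed.

Definition distribution q :=
  (forall d, 0 <= q d) /\ has_expectation q (fun=> 1) 1.

Lemma has_expectation_le_terms q q' F G l l' :
  (forall d, q d * F d <= q' d * G d) ->
  has_expectation q F l -> has_expectation q' G l' -> l <= l'.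
Proof.
move=> FG EF EG; apply: (ler_cvg_to EF EG); near=> B.
by apply: ler_sum => d _.
Unshelve. all: by end_near. Qed.

Section nonnegative.
Variable q : nat -> R.
Hypothesis q_ge0 : forall d, 0 <= q d.

Lemma has_expectation_le F G l l' : (forall d, F d <= G d) ->
  has_expectation q F l -> has_expectation q G l' -> l <= l'.
Proof.
move=> FG; apply: has_expectation_le_terms => d.
by rewrite ler_wpM2l.
Qed.

Lemma has_expectation_norm_le F G l l' : (forall d, `|F d| <= G d) ->
  has_expectation q F l -> has_expectation q G l' -> `|l| <= l'.
Proof.
move=> FG EF EG; rewrite ler_norml -mulN1r; apply/andP; split.
  apply: has_expectation_le (has_expectationZ (a := -1) EG) EF => d.
  by have := FG d; rewrite mulN1r ler_norml => /andP[].
apply: has_expectation_le EF EG => d.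
exact: le_trans (ler_norm _) (FG d).
Qed.

Lemma has_expectation_dominated F G l : (forall d, `|F d| <= G d) ->
  has_expectation q G l -> cvgn (series (fun d => q d * F d)).
Proof.
move=> FG EG; apply: normed_cvg.
apply: (@series_le_cvg _ _ (fun d => q d * G d)).
- by move=> d /=.
- by move=> d; rewrite mulr_ge0 // (le_trans _ (FG d)).
- by move=> d /=; rewrite normrM ger0_norm // ler_wpM2l.
- by apply/cvg_ex; exists l.
Qed.

Lemma sum_le_expectation F l B : (forall d, 0 <= F d) ->
  has_expectation q F l -> \sum_(d < B) q d * F d <= l.
Proof.
move=> F0 EF; rewrite -(big_mkord xpredT (fun d => q d * F d)).
have ndF : nondecreasing_seq (series (fun d => q d * F d)).
  by apply: nondecreasing_series => d _ _; rewrite mulr_ge0.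
rewrite -(cvg_lim _ EF) //; apply: nondecreasing_cvgn_le => //.
by apply/cvg_ex; exists l.
Qed.

Lemma expectation_ge0 F l : (forall d, 0 <= F d) ->
  has_expectation q F l -> 0 <= l.
Proof. by move=> F0 /(sum_le_expectation 0 F0); rewrite big_ord0. Qed.

Lemma term_le_expectation F l d : (forall d, 0 <= F d) ->
  has_expectation q F l -> q d * F d <= l.
Proof.
move=> F0 EF; apply: le_trans (sum_le_expectation d.+1 F0 EF).
by rewrite big_ord_recr lerDr sumr_ge0 // => i _; rewrite mulr_ge0.
Qed.

End nonnegative.

End expectation.

Section charfun.
Context {R : realType}.
Implicit Types (q : nat -> R) (mu s k c t : R).

Definition charfun_sum q mu (B : nat) t : R[i] :=
  \sum_(d < B) (q d)%:C%C * cis ((d%:R - mu) * t).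

Definition charfun q mu t : R[i] := Complex
  (limn (series (fun d => q d * cos ((d%:R - mu) * t))))
  (limn (series (fun d => q d * sin ((d%:R - mu) * t)))).

Lemma Re_charfun_sum q mu B t : complex.Re (charfun_sum q mu B t) =
  \sum_(d < B) q d * cos ((d%:R - mu) * t).
Proof. by rewrite Re_sum; apply: eq_bigr => d _; rewrite ReZ. Qed.

Lemma Im_charfun_sum q mu B t : complex.Im (charfun_sum q mu B t) =
  \sum_(d < B) q d * sin ((d%:R - mu) * t).
Proof. by rewrite Im_sum; apply: eq_bigr => d _; rewrite ImZ. Qed.

Section distribution.
Variables (q : nat -> R) (mu : R).
Hypothesis q_distr : distribution q.

Lemma has_expectation_cos t :
  has_expectation q (fun d => cos ((d%:R - mu) * t))
    (complex.Re (charfun q mu t)).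
Proof.
have [q_ge0 q_mass] := q_distr; apply: has_expectation_dominated q_mass => // d.
exact: cos_max.
Qed.

Lemma has_expectation_sin t :
  has_expectation q (fun d => sin ((d%:R - mu) * t))
    (complex.Im (charfun q mu t)).
Proof.
have [q_ge0 q_mass] := q_distr; apply: has_expectation_dominated q_mass => // d.
exact: sin_max.
Qed.

Lemma sum_distribution_le1 B : \sum_(d < B) q d <= 1.
Proof.
have [q_ge0 q_mass] := q_distr.
have := sum_le_expectation q_ge0 B (fun=> ler01) q_mass.
by under eq_bigr do rewrite mulr1.
Qed.

Lemma normc_charfun_sum_le1 B t : normc (charfun_sum q mu B t) <= 1.
Proof.
have [q_ge0 _] := q_distr; apply: le_trans (sum_distribution_le1 B).
apply: le_trans (normc_sum _ _) _; apply: ler_sum => d _.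
by rewrite normcM normc_cis mulr1 normc_real ger0_norm.
Qed.

Lemma cvg_Re_charfun_sum t : (fun B => complex.Re (charfun_sum q mu B t)) @ \oo
  --> complex.Re (charfun q mu t).
Proof.
under eq_fun do rewrite Re_charfun_sum.
by have := has_expectation_cos (t := t); rewrite /has_expectation seriesEord.
Qed.

Lemma cvg_Im_charfun_sum t : (fun B => complex.Im (charfun_sum q mu B t)) @ \oo
  --> complex.Im (charfun q mu t).
Proof.
under eq_fun do rewrite Im_charfun_sum.
by have := has_expectation_sin (t := t); rewrite /has_expectation seriesEord.
Qed.

Lemma cvg_Re_charfun_sumX n t :
  (fun B => complex.Re (charfun_sum q mu B t ^+ n)) @ \oo
  --> complex.Re (charfun q mu t ^+ n).
Proof.
by have [] := cvg_Re_Im_exprn n (@cvg_Re_charfun_sum t) (@cvg_Im_charfun_sum t).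
Qed.

End distribution.

Arguments has_expectation_cos {q} mu q_distr t.
Arguments has_expectation_sin {q} mu q_distr t.

Definition central_moments q mu s k :=
  [/\ has_expectation q (fun d => d%:R - mu) 0,
      has_expectation q (fun d => (d%:R - mu) ^+ 2) s &
      has_expectation q (fun d => (d%:R - mu) ^+ 4) k].

Section gaussian_approximation.
Variables (q : nat -> R) (mu s k : R).
Hypotheses (q_distr : distribution q) (q_moments : central_moments q mu s k).

Let q_ge0 : forall d, 0 <= q d. Proof. by have [] := q_distr. Qed.

Lemma second_moment_ge0 : 0 <= s.
Proof.
have [_ second _] := q_moments.
exact: (expectation_ge0 q_ge0 (fun d => sqr_ge0 (d%:R - mu)) second).
Qed.

Lemma fourth_moment_ge0 : 0 <= k.
Proof.
have [_ _ fourth] := q_moments.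
by apply: (expectation_ge0 q_ge0 _ fourth) => d; rewrite exprn_even_ge0.
Qed.

Lemma second_moment_le M : k <= M -> s <= 1 + M.
Proof.
have [_ q_mass] := q_distr; have [_ second fourth] := q_moments.
rewrite -(lerD2l 1) => /(le_trans _); apply.
apply: (has_expectation_le q_ge0 _ second
  (has_expectationD q_mass fourth)) => d.
rewrite (exprM _ 2 2); set y := _ ^+ 2.
by have := sqr_ge0 (y - 1); have := sqr_ge0 y; nra.
Qed.

Lemma has_expectation_taylor2 t :
  has_expectation q (fun d => 1 - ((d%:R - mu) * t) ^+ 2 / 2)
    (1 - s * t ^+ 2 / 2).
Proof.
have [_ q_mass] := q_distr; have [_ second _] := q_moments.
have := has_expectationB q_mass (has_expectationZ (a := t ^+ 2 / 2) second).
rewrite [t ^+ 2 / 2 * s]mulrC mulrA; apply: eq_has_expectation => d.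
by rewrite exprMn; ring.
Qed.

Lemma Re_charfun_taylor t :
  `|complex.Re (charfun q mu t) - (1 - s * t ^+ 2 / 2)| <= k / 24 * t ^+ 4.
Proof.
have [_ _ fourth] := q_moments.
have -> : k / 24 * t ^+ 4 = t ^+ 4 / 24 * k by ring.
apply: (has_expectation_norm_le q_ge0 _
  (has_expectationB (has_expectation_cos mu q_distr t)
    (has_expectation_taylor2 (t := t)))
  (has_expectationZ fourth)) => d.
apply: le_trans (cos_taylor4 _) _; rewrite exprMn; lra.
Qed.

Lemma Re_charfun_ge t : 1 - s * t ^+ 2 / 2 <= complex.Re (charfun q mu t).
Proof.
apply: (has_expectation_le q_ge0 _ (has_expectation_taylor2 (t := t))
  (has_expectation_cos mu q_distr t)) => d.
exact: cos_ge_taylor2.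
Qed.

Lemma Im_charfun_le t :
  `|complex.Im (charfun q mu t)| <= (1 + k) / 6 * `|t| ^+ 3.
Proof.
have [_ q_mass] := q_distr; have [first _ fourth] := q_moments.
have mean_scaled : has_expectation q (fun d => (d%:R - mu) * t) 0.
  rewrite -(mulr0 t); apply: eq_has_expectation (has_expectationZ first) => d.
  exact: mulrC.
have sin_sub_mean : has_expectation q
    (fun d => sin ((d%:R - mu) * t) - (d%:R - mu) * t)
    (complex.Im (charfun q mu t)).
  rewrite -[complex.Im _]subr0.
  exact: (has_expectationB (has_expectation_sin mu q_distr t) mean_scaled).
have -> : (1 + k) / 6 * `|t| ^+ 3 = `|t| ^+ 3 / 6 * (1 + k) by ring.
apply: (has_expectation_norm_le q_ge0 _ sin_sub_mean
  (has_expectationZ (has_expectationD q_mass fourth))) => d.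
apply: le_trans (sin_taylor3 _) _; rewrite normrM exprMn -mulrA mulrC.
rewrite ler_wpM2l ?divr_ge0 ?exprn_ge0 //.
have -> : (d%:R - mu) ^+ 4 = `|d%:R - mu| ^+ 4.
  by rewrite -normrX ger0_norm ?exprn_even_ge0.
have : 0 <= `|d%:R - mu| by []; set y := `|_| => y0.
have [y1|/ltW y1] := leP y 1.
  by rewrite (le_trans (exprn_ile1 _ y0 y1)) // lerDl exprn_ge0.
by rewrite (le_trans (ler_weXn2l y1 (isT : (3 <= 4)%N))) // lerDr.
Qed.

(* Letting t tend to 0, Re z >= 1 - s t^2 / 2 bounds the rate of decay by s. *)
Lemma decay_rate_le_second_moment c T : 0 < T ->
  (forall t, `|t| <= T -> normc (charfun q mu t) ^+ 2 <= 1 - c * t ^+ 2) ->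
  c <= s.
Proof.
move=> T0 decay; pose t := Num.min T (1 + s)^-1.
have s0 := second_moment_ge0; have s1 : 0 < 1 + s by rewrite ltr_wpDr.
have t0 : 0 < t by rewrite lt_min T0 invr_gt0.
have st : s * t ^+ 2 <= 1.
  have t_le : t <= (1 + s)^-1 by rewrite ge_min lexx orbT.
  have t1 : (1 + s) * t <= 1 by rewrite mulrC -ler_pdivlMr // mul1r.
  by have := mulr_ge0 s0 (ltW t0); nra.
have tT : `|t| <= T by rewrite ger0_norm ?(ltW t0) // ge_min lexx.
have Re_ge := Re_charfun_ge t.
have Re_sqr : complex.Re (charfun q mu t) ^+ 2 <= 1 - c * t ^+ 2.
  by apply: le_trans (decay t tT); rewrite sqr_normc lerDl sqr_ge0.
rewrite -(ler_pM2r (exprn_gt0 2 t0)).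
by have := sqr_ge0 (s * t ^+ 2); nra.
Qed.

Lemma Re_charfun_gauss t :
  `|complex.Re (charfun q mu t) - expR (- (s * t ^+ 2 / 2))|
  <= (k / 24 + s ^+ 2 / 8) * t ^+ 4.
Proof.
have x0 : 0 <= s * t ^+ 2 / 2.
  by rewrite divr_ge0 // mulr_ge0 ?second_moment_ge0 ?sqr_ge0.
have := ler_distD (1 - s * t ^+ 2 / 2) (complex.Re (charfun q mu t))
  (expR (- (s * t ^+ 2 / 2))).
move/le_trans; apply; rewrite mulrDl.
apply: lerD; first exact: Re_charfun_taylor.
by rewrite distrC (le_trans (expRN_taylor2 x0)) //; lra.
Qed.

Lemma charfun_gauss t :
  normc (charfun q mu t - (expR (- (s * t ^+ 2 / 2)))%:C%C) ^+ 2
  <= ((k / 24 + s ^+ 2 / 8) ^+ 2 * t ^+ 2 + ((1 + k) / 6) ^+ 2) * t ^+ 6.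
Proof.
have Re_le := ler_sqr_norm (Re_charfun_gauss t).
have Im_le := ler_sqr_norm (Im_charfun_le t).
have t6 : (`|t| ^+ 3) ^+ 2 = t ^+ 6.
  by rewrite -exprM -normrX ger0_norm ?exprn_even_ge0.
rewrite exprMn t6 in Im_le.
rewrite sqr_normc ReD ImD -[- _%:C%C]rmorphN /= addr0.
by apply: le_trans (lerD Re_le Im_le) _; lra.
Qed.

End gaussian_approximation.

(* x^k e^(-x) <= k^k at x = (N c / 4) t^2 turns each factor N t^2 into a
   constant. *)
Lemma gauss_absorb (N c t a b : R) : 0 < N -> 0 < c -> 0 <= a -> 0 <= b ->
  (N ^+ 2 * (a * t ^+ 6) + N * (b * t ^+ 4)) * expR (- (N * c / 4 * t ^+ 2))
  <= (a * (12 / c) ^+ 3 + b * (8 / c) ^+ 2) / N.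
Proof.
move=> N0 c0 a0 b0; set x := N * c / 4 * t ^+ 2.
have x0 : 0 <= x by rewrite mulr_ge0 ?sqr_ge0 // ltW // !mulr_gt0.
set e := expR (- x).
have -> : (N ^+ 2 * (a * t ^+ 6) + N * (b * t ^+ 4)) * e =
    a * (4 / c) ^+ 3 / N * (x ^+ 3 * e) + b * (4 / c) ^+ 2 / N * (x ^+ 2 * e).
  by rewrite /x; field; rewrite !gt_eqF.
have coef_ge0 (d : R) (i : nat) : 0 <= d -> 0 <= d * (4 / c) ^+ i / N.
  by move=> d0; rewrite divr_ge0 ?mulr_ge0 ?exprn_ge0 ?divr_ge0 // ltW.
have := ler_wpM2l (coef_ge0 b 2 b0) (exprn_expRN_le 2 x0).
have := ler_wpM2l (coef_ge0 a 3 a0) (exprn_expRN_le 3 x0) => le3 le2.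
apply: le_trans (lerD le3 le2) _.
rewrite [leRHS](_ : _ = a * (4 / c) ^+ 3 / N * 3%:R ^+ 3
  + b * (4 / c) ^+ 2 / N * 2%:R ^+ 2) //.
by field; rewrite !gt_eqF.
Qed.

Lemma expRN_half_exprn_le c t n : 0 <= c -> `|t| <= 4 ->
  expR (- (c * t ^+ 2 / 2)) ^+ n
  <= expR (16 * c) * expR (- (n.+2%:R * c / 4 * t ^+ 2)) ^+ 2.
Proof.
move=> c0 /ler_sqr_norm t16; rewrite -!expRM_natl -expRD ler_expR.
by rewrite -(natr1 n.+1) -(natr1 n); nra.
Qed.

Lemma norm_Re_expr_sub_gauss (z : R[i]) w a b c t n :
  let rho := expR (- (c * t ^+ 2 / 2)) in
  0 < c -> 0 <= a -> 0 <= b -> `|t| <= 4 ->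
  0 <= w -> w <= rho -> normc z <= rho ->
  normc (z - w%:C%C) ^+ 2 <= a * t ^+ 6 -> `|complex.Re z - w| <= b * t ^+ 4 ->
  `|complex.Re (z ^+ n.+2) - w ^+ n.+2|
  <= expR (16 * c) * (a * (12 / c) ^+ 3 + b * (8 / c) ^+ 2) / n.+2%:R
     * expR (- (n.+2%:R * c / 4 * t ^+ 2)).
Proof.
move=> rho c0 a0 b0 t4 w0 wrho zrho norm_le Re_le.
apply: le_trans (norm_Re_expr_sub n w0 wrho zrho) _.
set N : R := n.+2%:R; set v := expR (- (N * c / 4 * t ^+ 2)).
have N0 : 0 < N by []; have rho0 : 0 <= rho := expR_ge0 _.
have rho1 : rho <= 1.
  by rewrite expR_le1 oppr_le0 divr_ge0 // mulr_ge0 ?sqr_ge0 // ltW.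
set P := N ^+ 2 * (a * t ^+ 6) + N * (b * t ^+ 4).
have P0 : 0 <= P.
  apply: addr_ge0.
    by rewrite mulr_ge0 ?sqr_ge0 // (le_trans _ norm_le) ?sqr_ge0.
  by rewrite mulr_ge0 ?(ltW N0) // (le_trans _ Re_le).
apply: (@le_trans _ _ (rho ^+ n * P)).
  have -> : rho ^+ n * P =
      N ^+ 2 * rho ^+ n * (a * t ^+ 6) + N * rho ^+ n * (b * t ^+ 4).
    by rewrite /P; ring.
  apply: lerD; first by rewrite ler_wpM2l // mulr_ge0 ?exprn_ge0 ?sqr_ge0.
  rewrite ler_pM ?mulr_ge0 ?exprn_ge0 // ler_pM2l // exprS.
  by rewrite ler_piMl ?exprn_ge0.
apply: le_trans (ler_wpM2r P0 (expRN_half_exprn_le n (ltW c0) t4)) _.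
rewrite -/N -/v.
have -> : expR (16 * c) * v ^+ 2 * P = expR (16 * c) * v * (P * v) by ring.
have absorb := gauss_absorb t N0 c0 a0 b0; rewrite -/v -/P in absorb.
have ev0 : 0 <= expR (16 * c) * v by rewrite mulr_ge0 ?expR_ge0.
rewrite [leRHS](_ : _ = expR (16 * c) * v *
  ((a * (12 / c) ^+ 3 + b * (8 / c) ^+ 2) / N)); last by ring.
exact: ler_wpM2l.
Qed.

Lemma charfun_gauss_uniform (M : R) : 0 <= M ->
  exists a b : R, [/\ 0 < a, 0 < b & forall q mu s k t, distribution q ->
    central_moments q mu s k -> k <= M -> `|t| <= 4 ->
    let z := charfun q mu t in let w := expR (- (s * t ^+ 2 / 2)) in
    normc (z - w%:C%C) ^+ 2 <= a * t ^+ 6 /\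
    `|complex.Re z - w| <= b * t ^+ 4].
Proof.
move=> M0; pose b := M / 24 + (1 + M) ^+ 2 / 8.
pose a := b ^+ 2 * 16 + ((1 + M) / 6) ^+ 2.
have b0 : 0 < b by rewrite /b; nra.
have a0 : 0 < a by rewrite ltr_wpDr ?sqr_ge0 // mulr_gt0 ?exprn_gt0.
exists a, b; split=> // q mu s k t q_distr q_moments kM t4 z w.
have s0 := second_moment_ge0 q_distr q_moments.
have k0 := fourth_moment_ge0 q_distr q_moments.
have sM := second_moment_le q_distr q_moments kM.
have kb : k / 24 + s ^+ 2 / 8 <= b.
  by rewrite lerD ?ler_pM2r // ?lerXn2r ?nnegrE ?(le_trans s0).
split; last first.
  apply: le_trans (Re_charfun_gauss q_distr q_moments t) _.
  by rewrite ler_wpM2r ?exprn_even_ge0.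
apply: le_trans (charfun_gauss q_distr q_moments t) _.
rewrite ler_wpM2r ?exprn_even_ge0 //; apply: lerD.
  rewrite ler_pM ?sqr_ge0 //; last by have := ler_sqr_norm t4; lra.
  by rewrite lerXn2r ?nnegrE ?(ltW b0) // addr_ge0 ?divr_ge0 ?sqr_ge0.
by rewrite lerXn2r ?nnegrE ?divr_ge0 ?addr_ge0 // ler_pM2r // lerD2l.
Qed.

Lemma charfunX_gauss (M c : R) : 0 <= M -> 0 < c -> exists2 K : R, 0 < K &
  forall q mu s k t n, distribution q -> central_moments q mu s k -> k <= M ->
  c <= s -> normc (charfun q mu t) ^+ 2 <= 1 - c * t ^+ 2 -> `|t| <= 4 ->
  (1 < n)%N ->
  `|complex.Re (charfun q mu t ^+ n) - expR (- (n%:R * s / 2 * t ^+ 2))|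
  <= K / n%:R * expR (- (n%:R * c / 4 * t ^+ 2)).
Proof.
move=> M0 c0; have [a [b [a0 b0 gauss]]] := charfun_gauss_uniform M0.
exists (expR (16 * c) * (a * (12 / c) ^+ 3 + b * (8 / c) ^+ 2)).
  rewrite mulr_gt0 ?expR_gt0 //.
  by rewrite addr_gt0 // mulr_gt0 // exprn_gt0 // divr_gt0.
move=> q mu s k t [//|[//|n]] q_distr q_moments kM cs decay t4 _.
have [norm_le Re_le] := gauss q mu s k t q_distr q_moments kM t4.
have -> : expR (- (n.+2%:R * s / 2 * t ^+ 2)) =
    expR (- (s * t ^+ 2 / 2)) ^+ n.+2.
  by rewrite -expRM_natl; congr expR; ring.
apply: norm_Re_expr_sub_gauss => //; rewrite ?expR_ge0 ?(ltW a0) ?(ltW b0) //.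
  by rewrite ler_expR lerN2 ler_pM2r // ler_wpM2r ?sqr_ge0.
rewrite -ler_sqr ?nnegrE ?normc_ge0 ?expR_ge0 //; apply: le_trans decay _.
by rewrite -expRM_natl; apply: le_trans (expR_ge1Dx _) _; rewrite ler_expR; lra.
Qed.

End charfun.

(** * The local limit theorem *)

Section integrals.
Context {R : realType}.
Local Notation lebesgue := (@lebesgue_measure R).

Lemma gauss_normal_pdf (s t : R) : 0 < s ->
  expR (- (s * t ^+ 2)) =
  Num.sqrt (pi / s) * normal_pdf 0 (Num.sqrt (2 * s))^-1 t.
Proof.
move=> s0; set sigma := (Num.sqrt (2 * s))^-1.
have sigma2 : sigma ^+ 2 = (2 * s)^-1.
  by rewrite exprVn sqr_sqrtr // mulr_ge0 // ltW.
have sigma0 : sigma != 0 by rewrite invr_neq0 // gt_eqF // sqrtr_gt0 mulr_gt0.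
have c0 : 0 < Num.sqrt (pi / s) by rewrite sqrtr_gt0 divr_gt0 // pi_gt0.
rewrite normal_pdfE //= /normal_peak /normal_fun sigma2 subr0.
have -> : (2 * s)^-1 * pi *+ 2 = pi / s.
  by rewrite -mulr_natr; field; rewrite gt_eqF.
rewrite mulVKf ?gt_eqF //; congr expR.
by rewrite -mulr_natr; field; rewrite gt_eqF.
Qed.

Lemma integrable_gauss (s : R) : 0 < s ->
  lebesgue.-integrable setT (EFin \o (fun t : R => expR (- (s * t ^+ 2)))).
Proof.
move=> s0; have := integrable_normal_pdf 0 (Num.sqrt (2 * s))^-1.
move=> /(integrableZl measurableT (Num.sqrt (pi / s))).
by apply: eq_integrable => // t _ /=; rewrite gauss_normal_pdf // EFinM.
Qed.

Lemma Rintegral_gauss (s : R) : 0 < s ->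
  (\int[lebesgue]_t (expR (- (s * t ^+ 2))))%R = Num.sqrt (pi / s).
Proof.
move=> s0; under eq_Rintegral do rewrite gauss_normal_pdf //.
have := integrable_normal_pdf 0 (Num.sqrt (2 * s))^-1.
by move=> ?; rewrite RintegralZl // /Rintegral integral_normal_pdf mulr1.
Qed.

Lemma Rintegral_compare_gauss (g : R -> R) (T s k K : R) :
  0 < s -> 0 < k -> lebesgue.-integrable `[- T, T] (EFin \o g) ->
  (forall t, `|t| <= T ->
     `|g t - expR (- (s * t ^+ 2))| <= K * expR (- (k * t ^+ 2))) ->
  (forall t, T < `|t| ->
     expR (- (s * t ^+ 2)) <= K * expR (- (k * t ^+ 2))) ->
  `|(\int[lebesgue]_(t in `[- T, T]) g t)%R - Num.sqrt (pi / s)|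
  <= K * Num.sqrt (pi / k).
Proof.
move=> s0 k0 ig near_le far_le.
have is_gauss := integrable_gauss s0; have ik := integrable_gauss k0.
have igT : lebesgue.-integrable setT (EFin \o (g \_ `[- T, T])).
  by rewrite -restrict_EFin -integrable_mkcond.
have iK : lebesgue.-integrable setT
    (EFin \o (fun t : R => K * expR (- (k * t ^+ 2)))).
  by have := integrableZl measurableT K ik; apply: eq_integrable => // t _ /=.
have igs := integrableB measurableT igT is_gauss.
rewrite Rintegral_mkcond -Rintegral_gauss // -RintegralB //.
apply: (le_trans (le_normr_Rintegral _ _)) => //.
rewrite -Rintegral_gauss // -RintegralZl //; apply: le_Rintegral => //.
  by apply: eq_integrable (integrable_abse igs) => // t _ /=.
move=> t _; rewrite /patch mem_setE in_itv /= -ler_norml.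
case: (leP `|t| T) => tT; first exact: near_le.
by rewrite (_ : point = 0 :> R) // sub0r normrN ger0_norm ?expR_ge0 // far_le.
Qed.

Lemma continuous_cos_scale (w : R) : continuous (fun t : R => cos (w * t)).
Proof.
move=> t; apply: (@continuous_comp _ _ _ (fun t => w * t) (@cos R)).
  exact: mulrl_continuous.
exact: continuous_cos.
Qed.

Lemma continuous_cos_sum (c w : nat -> R) (n : nat) :
  continuous (fun t : R => \sum_(k < n) c k * cos (w k * t)).
Proof.
apply: (@continuous_big R _ _ _ _ add_continuous) => k _ t.
by apply: cvgM; [exact: cvg_cst|exact: continuous_cos_scale].
Qed.

Lemma continuous_integrable_itv (f : R -> R) (a b : R) : continuous f ->
  lebesgue.-integrable `[a, b] (EFin \o f).
Proof.
move=> cf; apply: continuous_compact_integrable; first exact: segment_compact.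
exact: continuous_subspaceT.
Qed.

Lemma is_derive_sin_scale (w t : R) :
  is_derive t 1 (fun t : R => sin (w * t)) (w * cos (w * t)).
Proof.
have -> : (fun t => sin (w * t)) = @sin R \o (w *: id) by [].
by apply: is_derive_eq; rewrite /GRing.scale /= mulr1 mulrC.
Qed.

Lemma Rintegral_cos (w T : R) : 0 < T -> w != 0 ->
  (\int[lebesgue]_(t in `[- T, T]) cos (w * t))%R = 2 * sin (w * T) / w.
Proof.
move=> T0 w0; pose F := w^-1 *: (fun t : R => sin (w * t)).
have dF (t : R) : is_derive t 1 F (cos (w * t)).
  have := is_deriveZ w^-1 (is_derive_sin_scale w t).
  by move/is_derive_eq; apply; rewrite /GRing.scale /= mulKf.
have cF (t : R) : {for t, continuous F}.
  apply: differentiable_continuous; apply/derivable1_diffP.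
  by have [] := dF t.
rewrite /Rintegral (@continuous_FTC2 _ _ F).
- by rewrite /F !fctE /GRing.scale /= mulrN sinN; field.
- by lra.
- by apply: continuous_subspaceT; exact: continuous_cos_scale.
- split.
  + by move=> t _; have [] := dF t.
  + by apply: cvg_at_right_filter; exact: cF.
  + by apply: cvg_at_left_filter; exact: cF.
- by move=> t _; rewrite derive1E; have [_ ->] := dF t.
Qed.

Lemma sin_intpi (j : int) : sin (j%:~R * pi) = 0 :> R.
Proof.
have sin_natpi (n : nat) : sin (n%:R * pi) = 0 :> R.
  elim: n => [|n IHn]; first by rewrite mul0r sin0.
  by rewrite -natr1 mulrDl mul1r sinDpi IHn oppr0.
case: j => n; first exact: sin_natpi.
by rewrite NegzE mulrNz mulNr sinN sin_natpi oppr0.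
Qed.

Lemma Rintegral_cos_lattice (p k N : nat) : (0 < p)%N ->
  (p%:Z %| k%:Z - N%:Z)%Z ->
  (\int[lebesgue]_(t in `[- (pi / p%:R), pi / p%:R])
     cos ((k%:R - N%:R) * t))%R = if k == N then 2 * pi / p%:R else 0.
Proof.
move=> p0 /dvdzP[j kNj]; have pR0 : 0 < p%:R :> R by rewrite ltr0n.
have T0 : 0 < pi / p%:R :> R by rewrite divr_gt0 ?pi_gt0.
case: eqVneq => [->|kN].
  under eq_Rintegral do rewrite subrr mul0r cos0.
  rewrite Rintegral_cst // mul1r [X in fine X](lebesgue_measure_itv `[_, _]) /=.
  rewrite lte_fin ifT; last by lra.
  by rewrite -EFinD /= opprK; ring.
have kN0 : k%:R - N%:R != 0 :> R by rewrite subr_eq0 eqr_nat.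
have kNE : k%:R - N%:R = j%:~R * p%:R :> R.
  by rewrite -[RHS](intrM _ j p%:Z) -kNj rmorphB.
rewrite Rintegral_cos // kNE (_ : _ * (pi / _) = j%:~R * pi).
  by rewrite sin_intpi mulr0 mul0r.
by field; rewrite gt_eqF.
Qed.

Lemma Rintegral_cos_sum (c w : nat -> R) (a b : R) (n : nat) :
  (\int[lebesgue]_(t in `[a, b]) (\sum_(k < n) c k * cos (w k * t)))%R =
  \sum_(k < n) c k * (\int[lebesgue]_(t in `[a, b]) cos (w k * t))%R.
Proof.
have ic k : lebesgue.-integrable `[a, b] (EFin \o (fun t => cos (w k * t))).
  exact/continuous_integrable_itv/continuous_cos_scale.
elim: n => [|n IHn].
  under eq_Rintegral do rewrite big_ord0.
  by rewrite big_ord0 Rintegral_cst // mul0r.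
under eq_Rintegral do rewrite big_ord_recr /=.
rewrite big_ord_recr -IHn RintegralD ?RintegralZl //=.
  exact/continuous_integrable_itv/continuous_cos_sum.
apply: continuous_integrable_itv => t.
by apply: cvgM; [exact: cvg_cst|exact: continuous_cos_scale].
Qed.

End integrals.

Section fourier_inversion.
Context {R : realType}.
Variables (q : nat -> R) (mu : R).
Local Notation lebesgue := (@lebesgue_measure R).

Lemma Re_charfun_sumX (B n : nat) (t : R) :
  let Q := (\poly_(d < B) q d) ^+ n in
  complex.Re (charfun_sum q mu B t ^+ n) =
  \sum_(k < size Q) Q`_k * cos ((k%:R - n%:R * mu) * t).
Proof.
move=> Q; pose toC : R -> R[i] := real_complex R.
have hornerE_cis (P : {poly R}) (A : nat) s : (size P <= A)%N ->
    (map_poly toC P).[cis t] * cis s =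
    \sum_(k < A) (P`_k)%:C%C * cis (k%:R * t + s).
  move=> sP; rewrite (@horner_coef_wide _ A) ?size_map_poly // mulr_suml.
  by apply: eq_bigr => k _; rewrite coef_map cisD cisMn mulrA.
have -> : charfun_sum q mu B t =
    (map_poly toC (\poly_(d < B) q d)).[cis t] * cis (- mu * t).
  rewrite (hornerE_cis _ B) ?size_poly //; apply: eq_bigr => d _.
  by rewrite coef_poly ltn_ord -mulrDl.
rewrite exprMn -cisMn -horner_exp -rmorphXn (hornerE_cis _ (size Q)) // Re_sum.
by apply: eq_bigr => k _; rewrite ReZ /=; congr (_ * cos _); ring.
Qed.

Lemma continuous_Re_charfun_sumX (B n : nat) :
  continuous (fun t : R => complex.Re (charfun_sum q mu B t ^+ n)).
Proof.
pose Q := (\poly_(d < B) q d) ^+ n.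
rewrite (_ : (fun t => _) = fun t : R =>
    \sum_(k < size Q) Q`_k * cos ((k%:R - n%:R * mu) * t)).
  exact: (@continuous_cos_sum R (nth 0 Q) (fun k => k%:R - n%:R * mu)).
by apply/funext => t; rewrite Re_charfun_sumX.
Qed.

Variables (r p n N : nat).
Hypothesis p_gt0 : (0 < p)%N.
Hypothesis q_lattice : forall d, q d != 0 -> (p%:Z %| d%:Z - r%:Z)%Z.
Hypothesis N_lattice : (p%:Z %| N%:Z - (r * n)%:Z)%Z.
Hypothesis mean : n%:R * mu = N%:R.

Lemma Rintegral_Re_charfun_sumX (B : nat) : (N < B)%N ->
  (\int[lebesgue]_(t in `[- (pi / p%:R), pi / p%:R])
     complex.Re (charfun_sum q mu B t ^+ n))%R = 2 * pi / p%:R * convpow q n N.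
Proof.
move=> NB; under eq_Rintegral do rewrite Re_charfun_sumX mean.
rewrite -(coef_poly_exprn _ _ NB); set Q := (\poly_(d < B) q d) ^+ n.
rewrite (Rintegral_cos_sum (fun k => Q`_k) (fun k => k%:R - N%:R)).
have Q_lattice k : Q`_k != 0 -> (p%:Z %| k%:Z - N%:Z)%Z.
  move=> Qk; have -> : k%:Z - N%:Z =
      (k%:Z - (r * n)%:Z) - (N%:Z - (r * n)%:Z) by ring.
  rewrite rpredB //; apply: (coef_exprn_support _ Qk) => d.
  by rewrite coef_poly; case: ifP => _; [exact: q_lattice|rewrite eqxx].
have term k : Q`_k * (\int[lebesgue]_(t in `[- (pi / p%:R), pi / p%:R])
    cos ((k%:R - N%:R) * t))%R = if k == N then 2 * pi / p%:R * Q`_N else 0.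
  have [Qk|Qk] := eqVneq Q`_k 0.
    by rewrite Qk mul0r; case: eqP => // <-; rewrite Qk mulr0.
  rewrite Rintegral_cos_lattice ?Q_lattice //.
  by case: eqVneq => [->|_]; rewrite ?mulr0 // mulrC.
under eq_bigr do rewrite term.
rewrite -big_mkcond /=; have [NQ|QN] := ltnP N (size Q).
  by rewrite (big_pred1 (Ordinal NQ)).
by rewrite nth_default // mulr0 big1.
Qed.

Hypothesis q_distr : distribution q.

Lemma fourier_inversion :
  lebesgue.-integrable `[- (pi / p%:R), pi / p%:R]
    (EFin \o (fun t => complex.Re (charfun q mu t ^+ n))) /\
  (\int[lebesgue]_(t in `[- (pi / p%:R), pi / p%:R])
     complex.Re (charfun q mu t ^+ n))%R = 2 * pi / p%:R * convpow q n N.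
Proof.
set T := pi / p%:R; set I := (2 * pi / p%:R * convpow q n N).
pose f B t := complex.Re (charfun_sum q mu B t ^+ n).
pose g t := complex.Re (charfun q mu t ^+ n).
have f_g t : f ^~ t @ \oo --> g t by exact: cvg_Re_charfun_sumX.
have mf B : measurable_fun `[- T, T] (f B).
  apply: measurable_funTS; apply: continuous_measurable_fun.
  exact: continuous_Re_charfun_sumX.
have mg : measurable_fun `[- T, T] g.
  by apply: (measurable_fun_cvg mf) => t _; exact: f_g.
have [] := @dominated_convergence _ _ R lebesgue `[- T, T] _
  (fun B => EFin \o f B) (EFin \o g) (cst 1%E).
- by [].
- by move=> B; apply/measurable_EFinP; exact: mf.
- exact/measurable_EFinP.
- by apply: aeW => t _; apply: cvg_EFin; [exact: nearW|exact: f_g].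
- by apply: continuous_integrable_itv; exact: cst_continuous.
- apply: aeW => t B _; rewrite lee_fin; apply: le_trans (norm_Re_le _) _.
  by rewrite normcX exprn_ile1 ?normc_ge0 ?normc_charfun_sum_le1.
move=> ig _ f_cvg; split=> //.
have f_cvgI :
    (\int[lebesgue]_(t in `[(- T)%R, T]) (f B t)%:E)%E @[B --> \oo] --> I%:E.
  apply: cvg_near_cst; exists N.+1 => // B NB.
  rewrite /I -(Rintegral_Re_charfun_sumX NB).
  rewrite /Rintegral fineK //; apply: integrable_fin_num => //.
  exact: continuous_integrable_itv (@continuous_Re_charfun_sumX B n).
by rewrite /Rintegral (cvg_unique _ f_cvg f_cvgI).
Qed.

End fourier_inversion.

Section local_limit.
Context {R : realType}.
Local Notation lebesgue := (@lebesgue_measure R).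

Lemma gauss_tail_le (n s c T t : R) : 0 < n -> 0 < c -> c <= s -> 0 < T ->
  T < `|t| ->
  expR (- (n * s / 2 * t ^+ 2))
  <= (4 / (c * T ^+ 2)) / n * expR (- (n * c / 4 * t ^+ 2)).
Proof.
move=> n0 c0 cs T0 Tt; set y := n * c / 4.
have y0 : 0 < y by rewrite divr_gt0 // mulr_gt0.
have T2 : T ^+ 2 <= t ^+ 2.
  by rewrite -(real_normK (num_real t)) lerXn2r ?nnegrE ?(ltW T0) // ltW.
have yT0 : 0 < y * T ^+ 2 by rewrite mulr_gt0 // exprn_gt0.
have split_exp : expR (- (n * s / 2 * t ^+ 2)) <=
    expR (- (y * T ^+ 2)) * expR (- (y * t ^+ 2)).
  rewrite -expRD ler_expR -opprD lerN2 -mulrDr.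
  apply: (@le_trans _ _ (y * (t ^+ 2 + t ^+ 2))).
    by rewrite ler_pM2l // lerD2r.
  have -> : y * (t ^+ 2 + t ^+ 2) = n * c / 2 * t ^+ 2 by rewrite /y; field.
  by rewrite ler_wpM2r ?sqr_ge0 // ler_pM2r // ler_pM2l.
apply: le_trans split_exp _; rewrite ler_wpM2r ?expR_ge0 //.
have -> : 4 / (c * T ^+ 2) / n = (y * T ^+ 2)^-1.
  by rewrite /y; field; rewrite !gt_eqF ?exprn_gt0.
by rewrite -[leRHS]mul1r ler_pdivlMr // mulrC (exprn_expRN_le 1) // ltW.
Qed.

Lemma charfun_integral_gauss (M c T : R) : 0 <= M -> 0 < c -> 0 < T <= 4 ->
  exists2 K : R, 0 < K & forall q mu s k n,
  distribution q -> central_moments q mu s k -> k <= M ->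
  (forall t, `|t| <= T -> normc (charfun q mu t) ^+ 2 <= 1 - c * t ^+ 2) ->
  lebesgue.-integrable `[- T, T]
    (EFin \o (fun t => complex.Re (charfun q mu t ^+ n))) ->
  (1 < n)%N ->
  `|(\int[lebesgue]_(t in `[- T, T])
       complex.Re (charfun q mu t ^+ n))%R - Num.sqrt (2 * pi / (n%:R * s))|
  <= K / n%:R * Num.sqrt (4 * pi / (n%:R * c)).
Proof.
move=> M0 c0 /andP[T0 T4]; have [K K0 gauss_le] := charfunX_gauss M0 c0.
exists (K + 4 / (c * T ^+ 2)).
  by rewrite addr_gt0 // divr_gt0 // mulr_gt0 ?exprn_gt0.
move=> q mu s k n q_distr q_moments kM decay ig n1.
have n0 : 0 < n%:R :> R by rewrite ltr0n ltnW.
have cs := decay_rate_le_second_moment q_distr q_moments T0 decay.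
have s0 := lt_le_trans c0 cs.
have -> : 2 * pi / (n%:R * s) = pi / (n%:R * s / 2) by field; rewrite !gt_eqF.
have -> : 4 * pi / (n%:R * c) = pi / (n%:R * c / 4) by field; rewrite !gt_eqF.
have tail0 : 0 <= 4 / (c * T ^+ 2).
  by rewrite divr_ge0 // mulr_ge0 ?sqr_ge0 // ltW.
have ns0 : 0 < n%:R * s / 2 by rewrite divr_gt0 // mulr_gt0.
have nc0 : 0 < n%:R * c / 4 by rewrite divr_gt0 // mulr_gt0.
apply: (Rintegral_compare_gauss ns0 nc0 ig) => t tT.
- have t4 := le_trans tT T4.
  have := gauss_le q mu s k t n q_distr q_moments kM cs (decay t tT) t4 n1.
  move=> /le_trans; apply.
  by rewrite ler_wpM2r ?expR_ge0 // ler_pM2r ?invr_gt0 // lerDl.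
- apply: le_trans (gauss_tail_le n0 c0 cs T0 tT) _.
  by rewrite ler_wpM2r ?expR_ge0 // ler_pM2r ?invr_gt0 // lerDr ltW.
Qed.

Lemma relative_local_error (p : nat) (Q n s c K M : R) :
  (0 < p)%N -> 0 < n -> 0 < s -> 0 < c -> 0 <= K -> s <= M ->
  `|2 * pi / p%:R * Q - Num.sqrt (2 * pi / (n * s))|
    <= K / n * Num.sqrt (4 * pi / (n * c)) ->
  `|Q * (Num.sqrt (2 * pi * n * s) / p%:R) - 1|
    <= K * Num.sqrt (2 * M / c) / n.
Proof.
move=> p_gt0 n0 s0 c0 K0 sM; have p0 : 0 < p%:R :> R by rewrite ltr0n.
have tau0 : 0 < 2 * pi :> R by rewrite mulr_gt0 ?pi_gt0.
set v := Num.sqrt (2 * pi * n * s).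
have v0 : 0 < v by rewrite sqrtr_gt0 !mulr_gt0 ?pi_gt0.
have gauss_mass : Num.sqrt (2 * pi / (n * s)) * v = 2 * pi.
  by rewrite /v -[2 * pi * n * s]mulrA sqrtr_div_mul ?mulr_gt0 // ltW.
have error_mass : Num.sqrt (4 * pi / (n * c)) * v <=
    2 * pi * Num.sqrt (2 * M / c).
  rewrite -[2 * pi in leRHS](gtr0_norm tau0) -sqrtr_sqr.
  rewrite -!sqrtrM ?sqr_ge0 ?divr_ge0 ?mulr_ge0 ?pi_ge0 ?(ltW n0) ?(ltW c0) //.
  have -> : 4 * pi / (n * c) * (2 * pi * n * s) = (2 * pi) ^+ 2 * (2 * s / c).
    by field; rewrite !gt_eqF.
  by rewrite ler_wsqrtr // ler_wpM2l ?sqr_ge0 // ler_pM2r ?invr_gt0 // ler_pM2l.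
have -> : Q * (v / p%:R) - 1 =
    (2 * pi / p%:R * Q - Num.sqrt (2 * pi / (n * s))) * (v / (2 * pi)).
  rewrite mulrBl [X in _ = _ - X]mulrA gauss_mass.
  by move: (2 * pi) tau0 (v) => tau tau0 u; field; rewrite !gt_eqF.
have vtau0 : 0 < v / (2 * pi) by rewrite divr_gt0.
rewrite normrM (gtr0_norm vtau0).
move=> /(ler_wpM2r (ltW vtau0))/le_trans; apply.
rewrite -[leLHS]mulrA [Num.sqrt _ * (v / _)]mulrA [leRHS]mulrAC.
rewrite ler_wpM2l ?divr_ge0 ?(ltW n0) // ler_pdivrMr //.
by rewrite [leRHS]mulrC.
Qed.

Lemma local_limit (M c : R) (p : nat) : 0 <= M -> 0 < c -> (0 < p)%N ->
  exists K : R, forall q mu s k r n N,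
  distribution q -> central_moments q mu s k -> k <= M ->
  (forall t, `|t| <= pi / p%:R ->
     normc (charfun q mu t) ^+ 2 <= 1 - c * t ^+ 2) ->
  (forall d, q d != 0 -> (p%:Z %| d%:Z - r%:Z)%Z) ->
  (p%:Z %| N%:Z - (r * n)%:Z)%Z -> n%:R * mu = N%:R -> (1 < n)%N ->
  `|convpow q n N * (Num.sqrt (2 * pi * n%:R * s) / p%:R) - 1| <= K / n%:R.
Proof.
move=> M0 c0 p0; have pR0 : 0 < p%:R :> R by rewrite ltr0n.
set T : R := pi / p%:R; have T0 : 0 < T by rewrite divr_gt0 ?pi_gt0.
have T4 : T <= 4.
  by apply: le_trans pi_le4; rewrite ler_pdivrMr // ler_peMr ?pi_ge0 // ler1n.
have T04 : 0 < T <= 4 by rewrite T0.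
have [K K0 integral_le] := charfun_integral_gauss M0 c0 T04.
exists (K * Num.sqrt (2 * (1 + M) / c)) => q mu s k r n N.
move=> q_distr q_moments kM decay q_lattice N_lattice mean n1.
have cs := decay_rate_le_second_moment q_distr q_moments T0 decay.
have s0 := lt_le_trans c0 cs.
have sM := second_moment_le q_distr q_moments kM.
have [ig inversion] := fourier_inversion p0 q_lattice N_lattice mean q_distr.
have := integral_le q mu s k n q_distr q_moments kM decay ig n1.
rewrite inversion.
by apply: relative_local_error; rewrite ?ltr0n // ?ltW // ltnW.
Qed.

End local_limit.

(** * Decay of the characteristic function *)

Lemma gcd_differences_gt0 (D : set nat) (p d1 d2 : nat) :
  is_gcd_differences D p -> D d1 -> D d2 -> d1 <> d2 -> (0 < p)%N.
Proof.
case: p => // -[diff_dvd _] D1 D2; have := diff_dvd _ _ D1 D2.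
by rewrite dvd0z subr_eq0 eqz_nat => /eqP.
Qed.

(* The least positive element of S divides S, hence all the differences, and
   thus their gcd. *)
Lemma gcd_differences_mem (S : int -> Prop) (D : set nat) (p d1 d2 : nat) :
  (forall k l, S k -> S l -> S (k - l)) ->
  (forall d e, D d -> D e -> S (d%:Z - e%:Z)) ->
  is_gcd_differences D p -> D d1 -> D d2 -> d1 <> d2 -> S p%:Z.
Proof.
move=> SB S_diff [_ p_max] D1 D2 d12.
have S0 : S 0 by rewrite -(subrr d1%:Z); exact: S_diff.
have SN k : S k -> S (- k) by rewrite -sub0r; exact: SB.
have SM k j : S k -> S (j * k).
  move=> Sk; have SMn (n : nat) : S (n%:Z * k).
    elim: n => [|n IHn]; first by rewrite mul0r.
    have -> : n.+1%:Z * k = n%:Z * k - (- k) by rewrite intS; ring.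
    exact/SB/SN.
  by case: j => n //; rewrite NegzE mulNr; exact/SN.
pose P g := `[< (0 < g)%N /\ S g%:Z >].
have exP : exists g, P g.
  exists `|d1%:Z - d2%:Z|%N; apply/asboolP.
  split; first by rewrite absz_gt0 subr_eq0 eqz_nat; apply/eqP.
  case: (d1%:Z - d2%:Z) (S_diff _ _ D1 D2) => n // /SN.
  by rewrite NegzE opprK.
case: (ex_minnP exP) => g /asboolP[g0 Sg] g_min.
have g_dvd k : S k -> (g%:Z %| k)%Z.
  move=> Sk; apply/dvdz_mod0P.
  have : S (k %% g%:Z)%Z by exact/SB/SM.
  have : (0 <= k %% g%:Z < g%:Z)%Z by rewrite modz_ge0 ?ltz_pmod // -lt0n.
  case: (k %% g%:Z)%Z => // -[|j] // jg Sj.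
  have : (g <= j.+1)%N by apply: g_min; apply/asboolP.
  by rewrite leqNgt -ltz_nat (andP jg).2.
have /dvdnP[j ->] : (g %| p)%N.
  by apply: p_max => d e Dd De; exact/g_dvd/S_diff.
by rewrite PoszM; exact: SM.
Qed.

Section decay.
Context {R : realType}.
Implicit Types (q : nat -> R) (mu c t : R) (D : set nat).

Lemma ler_sum_ord_widen (P : pred nat) (F : nat -> R) (B B' : nat) :
  (forall d, 0 <= F d) -> (B <= B')%N ->
  \sum_(d < B | P d) F d <= \sum_(d < B' | P d) F d.
Proof.
move=> F0 BB'; rewrite -!(big_mkord P).
by rewrite [leRHS](big_cat_nat (n := B)) //= lerDl sumr_ge0.
Qed.

Lemma ler_sum_ord_widen2 (P : pred nat) (F : nat -> nat -> R) (B B' : nat) :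
  (forall d e, 0 <= F d e) -> (B <= B')%N ->
  \sum_(d < B | P d) \sum_(e < B | P e) F d e
  <= \sum_(d < B' | P d) \sum_(e < B' | P e) F d e.
Proof.
move=> F0 BB'; apply: (@le_trans _ _
    (\sum_(d < B | P d) \sum_(e < B' | P e) F d e)).
  by apply: ler_sum => d _; exact: (ler_sum_ord_widen P (F0 d)).
apply: (ler_sum_ord_widen P (F := fun d => \sum_(e < B' | P e) F d e)) => // d.
by apply: sumr_ge0 => e _.
Qed.

Definition half_sin_sqr t (d e : nat) : R := sin ((d%:R - e%:R) * t / 2) ^+ 2.

Lemma half_sin_sqr_ge0 t d e : 0 <= half_sin_sqr t d e.
Proof. exact: sqr_ge0. Qed.

Lemma cos_half_sin_sqr mu t d e :
  cos ((d%:R - mu) * t) * cos ((e%:R - mu) * t)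
  + sin ((d%:R - mu) * t) * sin ((e%:R - mu) * t) = 1 - 2 * half_sin_sqr t d e.
Proof.
rewrite -cosB /half_sin_sqr; set y := (_ - _) * t / 2.
have -> : (d%:R - mu) * t - (e%:R - mu) * t = y + y by rewrite /y; field.
by rewrite cosD -!expr2; have := cos2Dsin2 y; lra.
Qed.

Lemma sqr_normc_charfun_sum q mu B t :
  normc (charfun_sum q mu B t) ^+ 2 = (\sum_(d < B) q d) ^+ 2
  - 2 * \sum_(d < B) \sum_(e < B) q d * q e * half_sin_sqr t d e.
Proof.
rewrite sqr_normc Re_charfun_sum Im_charfun_sum !expr2 !big_distrlr /=.
rewrite -big_split mulr_sumr -sumrB; apply: eq_bigr => d _ /=.
rewrite -big_split mulr_sumr -sumrB; apply: eq_bigr => e _ /=.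
have := cos_half_sin_sqr mu t d e; set h := half_sin_sqr t d e => E.
have -> : 2 * (q d * q e * h) = q d * q e * (1 - (1 - 2 * h)) by ring.
by rewrite -E; ring.
Qed.

Lemma weighted_half_sin_sqr_ge0 q t d e : (forall i, 0 <= q i) ->
  0 <= q d * q e * half_sin_sqr t d e.
Proof.
by move=> q_ge0; apply: mulr_ge0; [exact: mulr_ge0|exact: half_sin_sqr_ge0].
Qed.

Lemma sqr_normc_charfun_le q mu t B : distribution q ->
  normc (charfun q mu t) ^+ 2
  <= 1 - 2 * \sum_(d < B) \sum_(e < B) q d * q e * half_sin_sqr t d e.
Proof.
move=> q_distr; have [q_ge0 _] := q_distr.
have cvg_sqr_norm : (fun B => normc (charfun_sum q mu B t) ^+ 2) @ \oo -->
    normc (charfun q mu t) ^+ 2.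
  rewrite sqr_normc; under eq_fun do rewrite sqr_normc.
  have cRe := @cvg_Re_charfun_sum R q mu q_distr t.
  have cIm := @cvg_Im_charfun_sum R q mu q_distr t.
  rewrite !expr2; under eq_fun do rewrite !expr2.
  exact: (cvgD (cvgM cRe cRe) (cvgM cIm cIm)).
apply: (cvgr_to_le cvg_sqr_norm); near=> A.
have BA : (B <= A)%N by near: A; exists B.
have terms_ge0 d e := weighted_half_sin_sqr_ge0 t d e q_ge0.
rewrite sqr_normc_charfun_sum; apply: lerB.
  rewrite expr_le1 ?sumr_ge0 //; exact: sum_distribution_le1.
rewrite ler_pM2l //; exact: (ler_sum_ord_widen2 xpredT terms_ge0 BA).
Unshelve. all: by end_near. Qed.

Definition sin_energy D (B : nat) t : R :=
  \sum_(d < B | (d : nat) \in D) \sum_(e < B | (e : nat) \in D)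
    half_sin_sqr t d e.

Definition sin_dominated D (k : int) : Prop := exists (K : R) (B : nat),
  0 <= K /\ forall t, sin (k%:~R * t / 2) ^+ 2 <= K * sin_energy D B t.

Lemma sin_energy_ge0 D B t : 0 <= sin_energy D B t.
Proof. by do 2![apply: sumr_ge0 => ? _]; exact: half_sin_sqr_ge0. Qed.

Lemma sin_energy_le D B B' t : (B <= B')%N ->
  sin_energy D B t <= sin_energy D B' t.
Proof.
move=> BB'; apply: (@ler_sum_ord_widen2 (fun d => d \in D)) => // d e.
exact: half_sin_sqr_ge0.
Qed.

Lemma sin_energy_le_weighted q kappa D B t :
  (forall d, 0 <= q d) -> 0 <= kappa ->
  (forall d, (d < B)%N -> D d -> kappa <= q d) ->
  kappa ^+ 2 * sin_energy D B t
  <= \sum_(d < B) \sum_(e < B) q d * q e * half_sin_sqr t d e.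
Proof.
move=> q_ge0 kappa_ge0 kappa_le.
rewrite /sin_energy big_mkcond mulr_sumr; apply: ler_sum => d _.
case: ifPn => [/set_mem Dd|_]; last first.
  by rewrite mulr0 sumr_ge0 // => e _; exact: weighted_half_sin_sqr_ge0.
rewrite big_mkcond mulr_sumr; apply: ler_sum => e _.
case: ifPn => [/set_mem De|_]; last first.
  by rewrite mulr0; exact: weighted_half_sin_sqr_ge0.
by rewrite ler_wpM2r ?half_sin_sqr_ge0 // expr2 ler_pM ?kappa_le.
Qed.

Lemma sin_dominated_sub_mem D d e : D d -> D e -> sin_dominated D (d%:Z - e%:Z).
Proof.
move=> Dd De; exists 1, (maxn d e).+1; split=> // t; rewrite mul1r.
have dB : (d < (maxn d e).+1)%N by rewrite ltnS leq_maxl.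
have eB : (e < (maxn d e).+1)%N by rewrite ltnS leq_maxr.
rewrite /sin_energy (bigD1 (Ordinal dB)) ?mem_set //=.
rewrite (bigD1 (Ordinal eB)) ?mem_set //= rmorphB /= -/(half_sin_sqr t d e).
rewrite -addrA lerDl addr_ge0 //.
  by apply: sumr_ge0 => i _; exact: half_sin_sqr_ge0.
by do 2![apply: sumr_ge0 => ? _]; exact: half_sin_sqr_ge0.
Qed.

Lemma sin_sqrB_le (x y : R) : sin (x - y) ^+ 2 <= 2 * (sin x ^+ 2 + sin y ^+ 2).
Proof.
have cos_sqr_le1 z : cos z ^+ 2 <= 1 :> R.
  by rewrite -[leRHS](expr1n R 2) ler_sqr_norm ?cos_max.
have := ler_wpM2l (sqr_ge0 (sin x)) (cos_sqr_le1 y).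
have := ler_wpM2l (sqr_ge0 (sin y)) (cos_sqr_le1 x).
by rewrite sinB; have := sqr_ge0 (sin x * cos y + cos x * sin y); nra.
Qed.

Lemma sin_dominatedB D k l : sin_dominated D k -> sin_dominated D l ->
  sin_dominated D (k - l).
Proof.
move=> [K [B [K0 K_bound]]] [L [B' [L0 L_bound]]].
exists (2 * (K + L)), (maxn B B'); split; first by rewrite mulr_ge0 ?addr_ge0.
move=> t; rewrite rmorphB /= -mulrA mulrBl [_ * (t / 2)]mulrA [l%:~R * _]mulrA.
apply: le_trans (sin_sqrB_le _ _) _; rewrite -[leRHS]mulrA ler_pM2l // mulrDl.
apply: lerD.
  apply: le_trans (K_bound t) _; rewrite ler_wpM2l //.
  exact/sin_energy_le/leq_maxl.
apply: le_trans (L_bound t) _; rewrite ler_wpM2l //.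
exact/sin_energy_le/leq_maxr.
Qed.

Lemma charfun_decay D (p d1 d2 : nat) : is_gcd_differences D p ->
  D d1 -> D d2 -> d1 <> d2 ->
  exists B : nat, forall kappa : R, 0 < kappa -> exists2 c : R, 0 < c &
  forall q mu t, distribution q ->
  (forall d, (d < B)%N -> D d -> kappa <= q d) ->
  `|t| <= pi / p%:R -> normc (charfun q mu t) ^+ 2 <= 1 - c * t ^+ 2.
Proof.
move=> p_gcd D1 D2 d12; have p0 := gcd_differences_gt0 p_gcd D1 D2 d12.
have pR0 : 0 < p%:R :> R by rewrite ltr0n.
have [K [B [K0 sin_le_energy]]] := gcd_differences_mem (@sin_dominatedB D)
  (@sin_dominated_sub_mem D) p_gcd D1 D2 d12.
exists B => kappa kappa0; have K1 : 0 < K + 1 by rewrite ltr_wpDl.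
exists (2 * kappa ^+ 2 * (p%:R / 6) ^+ 2 / (K + 1)).
  by rewrite divr_gt0 // !mulr_gt0 ?invr_gt0.
move=> q mu t q_distr kappa_le tT; have [q_ge0 _] := q_distr.
apply: le_trans (sqr_normc_charfun_le mu t B q_distr) _.
have sin_ge : (p%:R / 6) ^+ 2 * t ^+ 2 <= (K + 1) * sin_energy D B t.
  have -> : (p%:R / 6) ^+ 2 * t ^+ 2 = (p%:R * t / 2 / 3) ^+ 2 by field.
  apply: le_trans (sqr_le_sin_sqr _) _; last first.
    apply: le_trans (sin_le_energy t) _.
    by rewrite ler_wpM2r ?sin_energy_ge0 ?lerDl.
  rewrite !normrM (gtr0_norm pR0) (@gtr0_norm _ 2^-1) ?invr_gt0 //.
  have : p%:R * `|t| <= pi by rewrite mulrC -ler_pdivlMr.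
  by have := @pi_le4 R; lra.
have energy_le := sin_energy_le_weighted t q_ge0 (ltW kappa0) kappa_le.
have -> : 2 * kappa ^+ 2 * (p%:R / 6) ^+ 2 / (K + 1) * t ^+ 2 =
    2 * (kappa ^+ 2 * ((p%:R / 6) ^+ 2 * t ^+ 2) / (K + 1)) by ring.
rewrite lerD2l lerN2 ler_pM2l // ler_pdivrMr //.
apply: le_trans (ler_wpM2l (sqr_ge0 kappa) sin_ge) _.
by rewrite mulrCA [leRHS]mulrC ler_pM2l.
Qed.

End decay.

(** * The Boltzmann distribution and the saddle point *)

Section boltzmann.
Context {R : realType}.
Implicit Types (D : set nat) (x y : R).

Lemma weight_ge0 D d : 0 <= weight R D d.
Proof. by rewrite divr_ge0. Qed.

Lemma weight_mem D d : D d -> weight R D d = d`!%:R^-1.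
Proof. by move=> Dd; rewrite /weight mem_set // mul1r. Qed.

Lemma weight_notin D d : ~ D d -> weight R D d = 0.
Proof. by move=> Dd; rewrite /weight memNset // mul0r. Qed.

Lemma weight_gt0 D d : D d -> 0 < weight R D d.
Proof. by move=> Dd; rewrite weight_mem // invr_gt0 ltr0n fact_gt0. Qed.

Lemma weight_le D d : weight R D d <= d`!%:R^-1.
Proof.
have [/weight_mem-> //|/weight_notin->] := pselect (D d).
by rewrite invr_ge0.
Qed.

Lemma weight_shiftD D d : weight R (shiftD D 1) d = d.+1%:R * weight R D d.+1.
Proof.
rewrite /weight (_ : (d \in shiftD D 1) = (d.+1 \in D)).
  by rewrite factS natrM invfM mulrCA mulVKf ?pnatr_eq0.
apply/idP/idP => /set_mem.
  by case=> e [De e1] <-; rewrite subn1 prednK //; exact/mem_set.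
by move=> Dd; apply/mem_set; exists d.+1; rewrite /= ?subn1.
Qed.

Definition tilt D x (d : nat) : R := weight R D d * x ^+ d.

Lemma tilt_ge0 D x d : 0 <= x -> 0 <= tilt D x d.
Proof. by move=> x0; rewrite mulr_ge0 ?weight_ge0 // exprn_ge0. Qed.

Lemma cvg_SetD D x : cvgn (pseries (weight R D) x).
Proof.
apply: normed_cvg; apply: (@series_le_cvg _ _ (exp_coeff `|x|)) => //.
- by move=> n /=.
- by move=> n; exact: exp_coeff_ge0.
- move=> n; rewrite /exp_coeff /= normrM (ger0_norm (weight_ge0 _ _)) normrX.
  by rewrite mulrC ler_wpM2l ?exprn_ge0 // weight_le.
exact: is_cvg_series_exp_coeff.
Qed.

Lemma has_expectation_tilt1 D x :
  has_expectation (tilt D x) (fun=> 1) (SetD D x).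
Proof.
rewrite /has_expectation; under eq_fun do rewrite mulr1.
exact: (@cvg_SetD D x).
Qed.

Arguments has_expectation_tilt1 : clear implicits.

Lemma has_expectation_tilt_shift D x F l :
  has_expectation (tilt (shiftD D 1) x) F l ->
  has_expectation (tilt D x) (fun d => d%:R * F d.-1) (x * l).
Proof.
rewrite /has_expectation => EF; rewrite -cvg_shiftS.
rewrite (_ : [sequence _]_n =
    x \*o series (fun d => tilt (shiftD D 1) x d * F d)); first exact: cvgMr.
apply/funext => B; rewrite /series /= big_nat_recl // mul0r mulr0 add0r.
rewrite mulr_sumr.
by apply: eq_bigr => d _; rewrite /tilt weight_shiftD exprS; ring.
Qed.

Lemma has_expectation_tilt_id D x :
  has_expectation (tilt D x) (fun d => d%:R) (x * SetD (shiftD D 1) x).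
Proof.
have := has_expectation_tilt_shift (has_expectation_tilt1 (shiftD D 1) x).
by apply: eq_has_expectation => d; rewrite mulr1.
Qed.

Arguments has_expectation_tilt_id : clear implicits.

Lemma has_expectation_tilt_sqr D x :
  has_expectation (tilt D x) (fun d => d%:R ^+ 2)
    (x * (x * SetD (shiftD (shiftD D 1) 1) x + SetD (shiftD D 1) x)).
Proof.
have := has_expectation_tilt_shift (has_expectationD
  (has_expectation_tilt_id (shiftD D 1) x)
  (has_expectation_tilt1 (shiftD D 1) x)).
by apply: eq_has_expectation => -[|d]; rewrite ?expr0n ?mul0r //= natr1 expr2.
Qed.

Arguments has_expectation_tilt_sqr : clear implicits.

Lemma has_expectation_tilt_exprn D x y :
  has_expectation (tilt D x) (fun d => y ^+ d) (SetD D (x * y)).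
Proof.
have := has_expectation_tilt1 D (x * y); rewrite /has_expectation.
by under eq_fun do rewrite mulr1 /tilt exprMn mulrA.
Qed.

Lemma tilt_le_SetD D x d : 0 <= x -> tilt D x d <= SetD D x.
Proof.
move=> x0; rewrite -[leLHS]mulr1.
apply: (term_le_expectation (fun d => tilt_ge0 D d x0) _ (F := fun=> 1)) => //.
exact: has_expectation_tilt1.
Qed.

Lemma SetD_ge0 D x : 0 <= x -> 0 <= SetD D x.
Proof.
by move=> x0; apply: le_trans (tilt_le_SetD D 0 x0); exact: tilt_ge0.
Qed.

Lemma SetD_gt0 D x d : D d -> 0 < x -> 0 < SetD D x.
Proof.
move=> Dd x0; apply: lt_le_trans (tilt_le_SetD D d (ltW x0)).
by rewrite mulr_gt0 ?exprn_gt0 ?weight_gt0.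
Qed.

Lemma SetD_le D x y : 0 <= x -> x <= y -> SetD D x <= SetD D y.
Proof.
move=> x0 xy; apply: lim_series_le; [exact: cvg_SetD|exact: cvg_SetD|] => d.
by rewrite /= ler_wpM2l ?weight_ge0 // lerXn2r ?nnegrE // (le_trans x0).
Qed.

Lemma is_derive_SetD D x : is_derive x 1 (@SetD R D) (SetD (shiftD D 1) x).
Proof.
have diffs_weight D' : pseries_diffs (weight R D') = weight R (shiftD D' 1).
  by apply/funext => d; rewrite weight_shiftD.
have := @pseries_snd_diffs R (weight R D) (`|x| + 1) x.
rewrite !diffs_weight; apply; try exact: cvg_SetD.
by rewrite [ltRHS]ger0_norm ?addr_ge0 // ltrDl.
Qed.

Definition boltzmann D x (d : nat) : R := tilt D x d / SetD D x.

Lemma has_expectation_boltzmann D x F l : has_expectation (tilt D x) F l ->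
  has_expectation (boltzmann D x) F (l / SetD D x).
Proof.
move=> EF; rewrite mulrC /has_expectation.
have -> : (fun d => boltzmann D x d * F d) =
    (fun d => tilt D x d * ((SetD D x)^-1 * F d)).
  by apply/funext => d; rewrite /boltzmann mulrA.
exact: has_expectationZ.
Qed.

Definition variance D x : R :=
  x * (x * SetD (shiftD (shiftD D 1) 1) x + SetD (shiftD D 1) x) / SetD D x
  - phi D x ^+ 2.

Section positive.
Variables (D : set nat) (r : nat) (x : R).
Hypotheses (Dr : D r) (x0 : 0 < x).

Let SetD0 : 0 < SetD D x. Proof. exact: SetD_gt0 Dr x0. Qed.

Lemma boltzmann_ge0 d : 0 <= boltzmann D x d.
Proof. by rewrite divr_ge0 ?tilt_ge0 // ltW. Qed.

Lemma distribution_boltzmann : distribution (boltzmann D x).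
Proof.
split; first exact: boltzmann_ge0.
rewrite -[X in has_expectation _ _ X](divff (lt0r_neq0 SetD0)).
exact/has_expectation_boltzmann/has_expectation_tilt1.
Qed.

Lemma has_expectation_boltzmann_sub v :
  has_expectation (boltzmann D x) (fun d => d%:R - v) (phi D x - v).
Proof.
have [_ mass] := distribution_boltzmann.
have := has_expectationB
  (has_expectation_boltzmann (has_expectation_tilt_id D x))
  (has_expectationZ (a := v) mass).
by rewrite mulr1.
Qed.

Arguments has_expectation_boltzmann_sub : clear implicits.

Lemma has_expectation_boltzmann_sqr :
  has_expectation (boltzmann D x) (fun d => (d%:R - phi D x) ^+ 2)
    (variance D x).
Proof.
have [_ mass] := distribution_boltzmann.
have := has_expectationB
  (has_expectation_boltzmann (has_expectation_tilt_sqr D x))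
  (has_expectationD
    (has_expectationZ (a := 2 * phi D x)
      (has_expectation_boltzmann_sub (phi D x)))
    (has_expectationZ (a := phi D x ^+ 2) mass)).
rewrite subrr mulr0 add0r mulr1.
by apply: eq_has_expectation => d; ring.
Qed.

Lemma is_derive_phi : is_derive x 1 (@phi R D) (variance D x / x).
Proof.
have -> : @phi R D = id * @SetD R (shiftD D 1) * (fun y => (SetD D y)^-1).
  by [].
have SetD_neq0 := lt0r_neq0 SetD0.
have := is_deriveM
  (is_deriveM (is_derive_id x 1) (is_derive_SetD (shiftD D 1) x))
  (is_deriveV SetD_neq0 (is_derive_SetD D x)).
move/is_derive_eq; apply; rewrite /GRing.scale /= /variance /phi !fctE.
by field; rewrite SetD_neq0 gt_eqF.
Qed.

Lemma derive1_phi : x * derive1 (@phi R D) x = variance D x.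
Proof.
rewrite derive1E; have [_ ->] := is_derive_phi.
by rewrite mulrC divfK // gt_eqF.
Qed.

Lemma continuous_phi : {for x, continuous (@phi R D)}.
Proof.
apply: differentiable_continuous; apply/derivable1_diffP.
by have [] := is_derive_phi.
Qed.

Lemma boltzmann_le d : boltzmann D x d <= tilt D x d * (r`!%:R / x ^+ r).
Proof.
rewrite ler_wpM2l ?tilt_ge0 ?(ltW x0) // -[leRHS]invrK lef_pV2 ?posrE //.
  by rewrite invf_div mulrC -(weight_mem Dr) tilt_le_SetD // ltW.
by rewrite invr_gt0 divr_gt0 ?exprn_gt0 // ltr0n fact_gt0.
Qed.

End positive.

Arguments has_expectation_boltzmann_sub {D r x} Dr x0 v.

Section two_degrees.
Variables (D : set nat) (d1 d2 : nat).
Hypotheses (D1 : D d1) (D2 : D d2) (d12 : d1 <> d2).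

Lemma variance_gt0 x : 0 < x -> 0 < variance D x.
Proof.
move=> x0; have [d Dd d_phi] : exists2 d, D d & d%:R - phi D x != 0.
  have [e1|] := eqVneq (d1%:R) (phi D x); last by exists d1; rewrite ?subr_eq0.
  by exists d2; rewrite // -e1 subr_eq0 eqr_nat; apply/eqP/nesym.
have := term_le_expectation (boltzmann_ge0 D1 x0) d
  (fun d => sqr_ge0 (d%:R - phi D x)) (has_expectation_boltzmann_sqr D1 x0).
apply: lt_le_trans; rewrite mulr_gt0 ?exprn_even_gt0 //.
rewrite divr_gt0 ?(SetD_gt0 D1) //.
by rewrite mulr_gt0 ?exprn_gt0 ?weight_gt0.
Qed.

Lemma phi_lt x y : 0 < x -> x < y -> phi D x < phi D y.
Proof.
move=> x0 xy; have pos z : z \in `]x, y[ -> 0 < z.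
  by rewrite in_itv /= => /andP[xz _]; apply: lt_trans xz.
have [||c cxy E] := @MVT R (@phi R D) (fun z => variance D z / z) x y xy.
- by move=> z /pos z0; exact: is_derive_phi D1 z0.
- apply: continuous_in_subspaceT => z; rewrite inE /= in_itv /= => /andP[xz _].
  by apply: (continuous_phi D1); apply: lt_le_trans xz.
rewrite -subr_gt0 E mulr_gt0 ?subr_gt0 // divr_gt0 ?(pos _ cxy) //.
exact: variance_gt0 (pos _ cxy).
Qed.

Lemma phi_inj x y : 0 < x -> 0 < y -> phi D x = phi D y -> x = y.
Proof.
move=> x0 y0 E; case: (ltgtP x y) => // xy.
  by have := phi_lt x0 xy; rewrite E ltxx.
by have := phi_lt y0 xy; rewrite E ltxx.
Qed.

End two_degrees.

Lemma phi_le_near0 D r x : is_min D r -> 0 < x -> x <= 1 ->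
  phi D x <= r%:R + x * r`!%:R * SetD (shiftD D 1) 1.
Proof.
move=> [Dr rmin] x0 x1; rewrite -lerBlDl.
have mean_at1 := has_expectationZ (a := x * r`!%:R)
  (has_expectation_tilt_id D 1).
rewrite mul1r in mean_at1; apply: (has_expectation_le_terms _
  (has_expectation_boltzmann_sub Dr x0 r%:R) mean_at1) => d.
have [Dd|Dd] := pselect (D d); last first.
  by rewrite /boltzmann /tilt weight_notin // !mul0r.
have := rmin d Dd; rewrite leq_eqVlt => /predU1P[<-|rd].
  by rewrite subrr mulr0 !mulr_ge0 ?tilt_ge0 // ltW.
have d_r : 0 <= d%:R - r%:R :> R by rewrite subr_ge0 ler_nat ltnW.
have d_r_le : d%:R - r%:R <= d%:R :> R by rewrite gerBl.
apply: le_trans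
  (ler_pM (boltzmann_ge0 Dr x0 d) d_r (boltzmann_le Dr x0 d) d_r_le) _.
have -> : tilt D x d * (r`!%:R / x ^+ r) * d%:R =
    tilt D 1 d * (x ^+ d / x ^+ r * r`!%:R * d%:R).
  by rewrite /tilt expr1n; ring.
rewrite ler_wpM2l ?tilt_ge0 // !ler_wpM2r // ler_pdivrMr ?exprn_gt0 // -exprS.
by rewrite ler_wiXn2l // ltW.
Qed.

Lemma phi_ge_near_infty D e x : D e -> 1 <= x ->
  e%:R - e%:R * e`!%:R * SetD D 1 / x <= phi D x.
Proof.
move=> De x1; have x0 : 0 < x by apply: lt_le_trans x1.
suff lower : - (e%:R * e`!%:R / x) * SetD D 1 <= phi D x - e%:R by lra.
apply: (has_expectation_le_terms _
  (has_expectationZ (has_expectation_tilt1 D 1))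
  (has_expectation_boltzmann_sub De x0 e%:R)) => d.
rewrite mulr1 mulrN lerNl -mulrN opprB.
have [ed|de] := leqP e d.
  apply: (@le_trans _ _ 0).
    by rewrite mulr_ge0_le0 ?(boltzmann_ge0 De) // subr_le0 ler_nat.
  by rewrite mulr_ge0 ?tilt_ge0 // divr_ge0 ?mulr_ge0 // ltW.
have e_d : 0 <= e%:R - d%:R :> R by rewrite subr_ge0 ler_nat ltnW.
have e_d_le : e%:R - d%:R <= e%:R :> R by rewrite gerBl.
apply: le_trans
  (ler_pM (boltzmann_ge0 De x0 d) e_d (boltzmann_le De x0 d) e_d_le) _.
have -> : tilt D x d * (e`!%:R / x ^+ e) * e%:R =
    tilt D 1 d * (e%:R * e`!%:R * (x ^+ d / x ^+ e)).
  by rewrite /tilt expr1n; ring.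
rewrite ler_wpM2l ?tilt_ge0 // ler_wpM2l // ler_pdivrMr ?exprn_gt0 // mulrC.
by rewrite ler_pdivlMr // -exprSr ler_weXn2l.
Qed.


Lemma phi_lt_near0 D r (a : R) : is_min D r -> r%:R < a ->
  exists2 x, 0 < x <= 1 & phi D x < a.
Proof.
move=> rmin ra; pose F : R := r`!%:R * SetD (shiftD D 1) 1 + 1.
have F0 : 0 < F by rewrite ltr_wpDl // mulr_ge0 // SetD_ge0.
pose x := Num.min 1 ((a - r%:R) / F).
have x0 : 0 < x by rewrite lt_min ltr01 divr_gt0 // subr_gt0.
have x1 : x <= 1 by rewrite ge_min lexx.
exists x; first by rewrite x0.
have xF : x * F <= a - r%:R by rewrite -ler_pdivlMr // ge_min lexx orbT.
apply: le_lt_trans (phi_le_near0 rmin x0 x1) _.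
by rewrite -ltrBrDl; apply: lt_le_trans xF; rewrite -mulrA ltr_pM2l // ltrDl.
Qed.

Lemma phi_gt_near_infty D e (b : R) : D e -> b < e%:R ->
  exists2 x, 1 <= x & b < phi D x.
Proof.
move=> De be; pose F : R := e%:R * e`!%:R * SetD D 1.
have F0 : 0 <= F by rewrite !mulr_ge0 // SetD_ge0.
have eb : 0 < e%:R - b by rewrite subr_gt0.
pose x := F / (e%:R - b) + 1.
have x1 : 1 <= x by rewrite lerDr divr_ge0 // ltW.
exists x => //; apply: lt_le_trans (phi_ge_near_infty De x1).
rewrite -/F ltrBrDr -ltrBrDl ltr_pdivrMr ?(lt_le_trans _ x1) //.
by rewrite mulrDr mulr1 mulrC divfK ?gt_eqF // ltrDl.
Qed.

Lemma saddle_point_exists D r e (a b : R) : is_min D r -> D e ->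
  r%:R < a -> b < e%:R ->
  exists alpha beta : R, [/\ 0 < alpha, alpha <= beta & forall v, a <= v <= b ->
    exists2 x, alpha <= x <= beta & phi D x = v].
Proof.
move=> rmin De ra be; have [Dr _] := rmin.
have [alpha /andP[alpha0 alpha1] phi_alpha] := phi_lt_near0 rmin ra.
have [beta beta1 phi_beta] := phi_gt_near_infty De be.
have alpha_beta : alpha <= beta by apply: le_trans beta1.
exists alpha, beta; split=> // v /andP[av vb].
have [||x] := @IVT R (@phi R D) alpha beta v alpha_beta.
- apply: continuous_in_subspaceT => z; rewrite inE /= in_itv /= => /andP[az _].
  by apply: (continuous_phi Dr); apply: lt_le_trans az.
- rewrite ge_min le_max (le_trans (ltW phi_alpha) av).
  by rewrite (le_trans vb (ltW phi_beta)) orbT.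
by rewrite in_itv /= => x_in phix; exists x.
Qed.

End boltzmann.

Section uniform_bounds.
Context {R : realType} (D : set nat) (r : nat) (alpha beta : R).
Hypotheses (Dr : D r) (alpha0 : 0 < alpha) (alpha_beta : alpha <= beta).

Lemma boltzmann_bounded_below (B : nat) : exists2 kappa : R, 0 < kappa &
  forall x d, alpha <= x <= beta -> (d < B)%N -> D d ->
  kappa <= boltzmann D x d.
Proof.
pose g : R := Num.min 1 alpha.
have g0 : 0 < g by rewrite lt_min ltr01.
have beta0 : 0 < beta by apply: lt_le_trans alpha_beta.
have SetD_beta0 := SetD_gt0 Dr beta0.
have B0 : 0 < B`!%:R :> R by rewrite ltr0n fact_gt0.
exists (B`!%:R^-1 * g ^+ B / SetD D beta).
  by rewrite divr_gt0 // mulr_gt0 ?exprn_gt0 // invr_gt0.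
move=> x d /andP[ax xb] dB Dd; have x0 : 0 < x by apply: lt_le_trans ax.
have gx : g <= x by apply: le_trans ax; rewrite ge_min lexx orbT.
have gd : g ^+ B <= x ^+ d.
  apply: (@le_trans _ _ (g ^+ d)).
    by rewrite ler_wiXn2l ?(ltW g0) ?ge_min ?lexx // ltnW.
  by rewrite lerXn2r ?nnegrE ?(ltW g0) ?(ltW x0).
rewrite /boltzmann /tilt weight_mem // ler_pM ?invr_ge0 //.
- by rewrite mulr_ge0 ?invr_ge0 ?exprn_ge0 // ltW.
- exact: ltW.
- rewrite ler_pM ?invr_ge0 ?exprn_ge0 ?(ltW g0) //.
  rewrite lef_pV2 ?posrE ?ltr0n ?fact_gt0 //.
  by rewrite ler_nat; exact/leq_fact/ltnW.
- by rewrite lef_pV2 ?posrE ?(SetD_gt0 Dr) //; exact: SetD_le (ltW x0) xb.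
Qed.

Lemma exprn4_sub_le (b mu : R) (d : nat) : 0 <= mu -> mu <= b ->
  (d%:R - mu) ^+ 4 <= (1 + b) ^+ 4 * 16 ^+ d.
Proof.
move=> mu0 mub; have d_le : d%:R <= 2 ^+ d :> R.
  by rewrite -natrX ler_nat ltnW // ltn_expl.
have d_ge1 : 1 <= 2 ^+ d :> R by rewrite exprn_ege1 // ler1n.
have dmu_le : `|d%:R - mu| <= (1 + b) * 2 ^+ d.
  by have := ler0n R d; rewrite ler_norml; nra.
have -> : (1 + b) ^+ 4 * 16 ^+ d = ((1 + b) * 2 ^+ d) ^+ 4.
  by rewrite exprMn -exprM mulnC exprM; congr (_ * _ ^+ d); ring.
rewrite -[leLHS]ger0_norm ?exprn_even_ge0 // normrX.
by rewrite lerXn2r ?nnegrE // (le_trans _ dmu_le).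
Qed.

Lemma boltzmann_central_moments : exists2 M : R, 0 <= M &
  forall x, alpha <= x <= beta -> exists2 k, k <= M &
  central_moments (boltzmann D x) (phi D x) (variance D x) k.
Proof.
have beta0 : 0 < beta by apply: lt_le_trans alpha_beta.
have SetD_alpha0 := SetD_gt0 Dr alpha0.
pose b := beta * SetD (shiftD D 1) beta / SetD D alpha.
have b0 : 0 <= b by rewrite divr_ge0 ?mulr_ge0 ?SetD_ge0 // ltW.
exists ((1 + b) ^+ 4 * (SetD D (beta * 16) / SetD D alpha)).
  rewrite mulr_ge0 ?exprn_ge0 ?addr_ge0 //.
  by rewrite divr_ge0 ?SetD_ge0 ?mulr_ge0 // ltW.
move=> x /andP[ax xb]; have x0 : 0 < x by apply: lt_le_trans ax.
have SetD0 := SetD_gt0 Dr x0.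
have invSetD_le : (SetD D x)^-1 <= (SetD D alpha)^-1.
  by rewrite lef_pV2 ?posrE //; exact: SetD_le (ltW alpha0) ax.
have phi0 : 0 <= phi D x.
  by rewrite divr_ge0 ?mulr_ge0 ?SetD_ge0 ?(ltW x0) // ltW.
have phib : phi D x <= b.
  rewrite ler_pM ?mulr_ge0 ?invr_ge0 ?SetD_ge0 ?(ltW x0) ?(ltW SetD0) //.
  by rewrite ler_pM ?SetD_ge0 ?SetD_le // ltW.
have [q_ge0 _] := distribution_boltzmann Dr x0.
have exprn16 := has_expectationZ (a := (1 + b) ^+ 4) (has_expectation_boltzmann
  (has_expectation_tilt_exprn (D := D) (x := x) (y := 16))).
have exprn4_le d : `|(d%:R - phi D x) ^+ 4| <= (1 + b) ^+ 4 * 16 ^+ d.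
  by rewrite ger0_norm ?exprn_even_ge0 ?exprn4_sub_le.
have fourth := has_expectation_dominated q_ge0 exprn4_le exprn16.
exists (limn (series (fun d => boltzmann D x d * (d%:R - phi D x) ^+ 4))).
  apply: le_trans (ler_norm _) _.
  apply: le_trans (has_expectation_norm_le q_ge0 exprn4_le fourth exprn16) _.
  rewrite ler_wpM2l ?exprn_ge0 ?addr_ge0 //.
  rewrite ler_pM ?SetD_ge0 ?invr_ge0 ?mulr_ge0 ?(ltW x0) ?(ltW SetD0) //.
  by rewrite SetD_le ?mulr_ge0 ?(ltW x0) // ler_pM2r.
split=> //; last exact: has_expectation_boltzmann_sqr Dr x0.
have := has_expectation_boltzmann_sub (v := phi D x) Dr x0.
by rewrite subrr.
Qed.

End uniform_bounds.

(** * The asymptotics of the coefficients *)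

Lemma coef_SetD_asymptotics (R : realType) (D : set nat) (r p d1 d2 : nat)
    (alpha beta : R) :
  D r -> D d1 -> D d2 -> d1 <> d2 -> is_gcd_differences D p ->
  0 < alpha -> alpha <= beta ->
  exists C : R, forall x n N, alpha <= x <= beta -> phi D x = N%:R / n%:R ->
  (p%:Z %| N%:Z - (r * n)%:Z)%Z -> (1 < n)%N ->
  exists eps : R, `|eps| <= C / n%:R /\
    convpow (weight R D) n N =
    p%:R / Num.sqrt (2 * pi * n%:R * x * derive1 (@phi R D) x)
    * (SetD D x ^+ n / x ^+ N) * (1 + eps).
Proof.
move=> Dr D1 D2 d12 p_gcd alpha0 alpha_beta.
have [B decay] := @charfun_decay R _ _ _ _ p_gcd D1 D2 d12.
have [kappa kappa0 kappa_le] := boltzmann_bounded_below Dr alpha0 alpha_beta B.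
have [c c0 {}decay] := decay kappa kappa0.
have [M M0 moments] := boltzmann_central_moments Dr alpha0 alpha_beta.
have [C relative_le] := local_limit M0 c0 (gcd_differences_gt0 p_gcd D1 D2 d12).
exists C => x n N x_in phix N_lattice n1.
have x0 : 0 < x by case/andP: x_in => ax _; exact: lt_le_trans ax.
have q_distr := distribution_boltzmann Dr x0.
have [k kM q_moments] := moments x x_in.
have lattice d : boltzmann D x d != 0 -> (p%:Z %| d%:Z - r%:Z)%Z.
  have [Dd _|Dd] := pselect (D d); first by case: p_gcd => dvd _; exact: dvd.
  by rewrite /boltzmann /tilt weight_notin // !mul0r eqxx.
have decay_x t : `|t| <= pi / p%:R ->
    normc (charfun (boltzmann D x) (phi D x) t) ^+ 2 <= 1 - c * t ^+ 2.
  by apply: decay => // d dB Dd; exact: kappa_le.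
have mean : n%:R * phi D x = N%:R.
  by rewrite phix mulrC divfK // pnatr_eq0 -lt0n ltnW.
have := relative_le _ _ _ _ _ _ _ q_distr q_moments kM decay_x
  lattice N_lattice mean n1.
rewrite convpow_scale -mulrA -(derive1_phi Dr x0) [_ * (x * _)]mulrA exprVn.
set v := Num.sqrt _ => eps_le; eexists; split; first exact: eps_le.
have v0 : v != 0.
  rewrite gt_eqF // sqrtr_gt0 -mulrA (derive1_phi Dr x0).
  by rewrite !mulr_gt0 ?pi_gt0 ?ltr0n ?(variance_gt0 D1 D2) // ltnW.
have p0 : p%:R != 0 :> R.
  by rewrite pnatr_eq0 -lt0n (gcd_differences_gt0 p_gcd D1 D2).
have S0 : SetD D x ^+ n != 0 by rewrite expf_neq0 // gt_eqF ?(SetD_gt0 Dr).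
have X0 : x ^+ N != 0 by rewrite expf_neq0 // gt_eqF.
rewrite [1 + _]addrC subrK; move: (SetD D x ^+ n) (x ^+ N) S0 X0 => S X S0 X0.
by field; rewrite p0 v0 S0 X0.
Qed.

Theorem theorem3 (R : realType) (D : set nat) (r p : nat) (a b : R)
  (D_ge2 : exists d1 d2 : nat, [/\ D d1, D d2 & d1 <> d2])
  (r_min : is_min D r)
  (p_gcd : is_gcd_differences D p)
  (r_lt_a : r%:R < a) (a_le_b : a <= b) (b_lt_max : (b%:E < maxD R D)%E) :
  exists (C : R) (N : nat), forall n m : nat,
    (0 < n)%N ->
    a <= (2 * m)%:R / n%:R <= b ->
    (p%:Z %| (2 * m)%:Z - (r * n)%:Z)%Z ->
    exists zeta : R,
      [/\ 0 < zeta,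
          phi D zeta = (2 * m)%:R / n%:R,
          (forall z : R, 0 < z -> phi D z = (2 * m)%:R / n%:R -> z = zeta)
        & (N <= n)%N -> (N <= m)%N ->
          exists eps : R,
            `|eps| <= C / n%:R /\
            \sum_(G : multigraph n m | degrees_in D G) kappa R G
              = main_term D p n m zeta * (1 + eps)].
Proof.
have [d1 [d2 [D1 D2 d12]]] := D_ge2; have [Dr _] := r_min.
have [_ [e De <-]] := ereal_sup_gt b_lt_max; rewrite lte_fin => be.
have [alpha [beta [alpha0 alpha_beta saddle]]] :=
  saddle_point_exists r_min De r_lt_a be.
have [C coef_le] :=
  coef_SetD_asymptotics Dr D1 D2 d12 p_gcd alpha0 alpha_beta.
exists C, 2%N => n m _ /saddle[zeta zeta_in phi_zeta] m_lattice.
have zeta0 : 0 < zeta by case/andP: zeta_in => az _; exact: lt_le_trans az.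
exists zeta; split=> // [z z0 phi_z|n2 _].
  by apply: (phi_inj D1 D2 d12) => //; rewrite phi_z.
have [eps [eps_le coefE]] := coef_le _ _ _ zeta_in phi_zeta m_lattice n2.
by exists eps; rewrite sum_kappa coefE /main_term !mulrA.
Qed.
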